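(* Let $d\ge1$. For each $N\ge 1$, let $f=f_N$ be the discrete-time ballistic deposition process with updates in $B_N := [-N,N]^d\cap\mathbb{Z}^d$, started from $f(0,\cdot)\equiv 0$. Given $p\in(0,1)$, generate $n$ from the geometric distribution with success probability $p$ (independently of the process $f$), and let $u_p(x) := f(n,x)-f(n,0)$ for $x\in\mathbb{Z}^d$. Suppose that $\{p(N)\}_{N\ge1}$ is a sequence of numbers in $(0,1)$ such that $N^{-d-1}\ll p(N)\ll N^{-d}$ as $N\to\infty$. Then the sequence $\{u_{p(N)}\}_{N\ge 1}$ (where $u_{p(N)}$ is built from $f_N$) is a tight family of random elements of $\Omega=\mathbb{Z}^{\mathbb{Z}^d}$, and every weakly convergent subsequence converges to a stationary distribution of the Markov process $\{h(t,\cdot)-h(t,0)\}_{t\ge0}$, where $h$ is the continuous-time ballistic deposition process on $\mathbb{Z}^d$.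
   Context: Let $\Omega := \mathbb{Z}^{\mathbb{Z}^d}$ with the product topology ($\mathbb{Z}$ discrete) and its Borel $\sigma$-algebra; $e_1,\ldots,e_d$ are the standard basis vectors of $\mathbb{R}^d$. The notation $a_N\ll b_N$ means $a_N/b_N\to0$ as $N\to\infty$. Discrete-time process: start with $f(0,x)=0$ for all $x\in\mathbb{Z}^d$. At each time $n=0,1,2,\ldots$ draw a vertex $x$ uniformly at random from $B_N$ (independently over time), set $$f(n+1,x) := \max\Bigl\{\max_{1\le i\le d} f(n,x\pm e_i),\ f(n,x)+1\Bigr\}$$ (inner maximum over all $i$ and both signs), and $f(n+1,y):=f(n,y)$ for all $y\ne x$ in $\mathbb{Z}^d$. The geometric distribution with success probability $p$ is $\mathbb{P}(n=j)=p(1-p)^j$, $j=0,1,2,\ldots$. Continuous-time ballistic deposition: at each site $x\in\mathbb{Z}^d$ there is an independent Poisson clock of rate $1$ on $[0,\infty)$. Given an initial condition $h(0,\cdot)\in\Omega$, whenever the clock at $x$ rings at time $t$, the height at $x$ is instantaneously updated to $\max\{\max_{1\le i\le d}h(t,x\pm e_i),\,h(t,x)+1\}$, which is the value of $h(s,x)$ for $s\in(t,t']$, $t'$ being the next ringing time at $x$. Precisely: for finite $D\subseteq\mathbb{Z}^d$ one performs only the updates at sites of $D$, in temporal order; the resulting heights are nondecreasing in $D$, and $h(t,x)$ is the limit as $D\uparrow\mathbb{Z}^d$, which is almost surely finite. The process $w(t,\cdot)=h(t,\cdot)-h(t,0)$ is a time-homogeneous Markov process on $\Omega$; a stationary distribution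 is a probability measure $\mu$ on $\Omega$ such that if $w(0,\cdot)$ has law $\mu$ (independent of the clocks), then $w(t,\cdot)$ has law $\mu$ for every $t\ge0$. *)

(* Defs.v *)
From HB Require Import structures.
From mathcomp Require Import all_boot all_order all_algebra finmap.
From mathcomp Require Import all_classical all_reals all_analysis.

Set Implicit Arguments.
Unset Strict Implicit.
Unset Printing Implicit Defensive.
Import Order.TTheory GRing.Theory Num.Theory.
Import numFieldNormedType.Exports.
Local Open Scope classical_set_scope.
Local Open Scope ring_scope.

Definition site (d : nat) : Type := 'rV[int]_d.

HB.instance Definition _ d := GRing.Zmodule.copy (site d) 'rV[int]_d.
HB.instance Definition _ d := Countable.copy (site d) 'rV[int]_d.
HB.instance Definition _ d := isPointed.Build (site d) 0.
HB.instance Definition _ d := @isMeasurable.Build default_measure_display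
  (site d) discrete_measurable discrete_measurable0
  discrete_measurableC discrete_measurableU.

Definition basis_vec d (i : 'I_d) : site d := delta_mx 0 i.

(* The space Omega = Z^(Z^d) of height functions. *)
Definition config (d : nat) : Type := {ptws site d -> discrete_topology int}.

HB.instance Definition _ d :=
  Uniform.copy (config d) {ptws site d -> discrete_topology int}.
HB.instance Definition _ d := isPointed.Build (config d) (fun=> 0).
HB.instance Definition _ d :=
  Measurable.copy (config d) (g_sigma_algebraType (@open (config d))).

Section probability.
Context {R : realType}.

Definition has_law d d' (T : measurableType d) (U : measurableType d')
    (P : probability T R) (X : T -> U) (mu : probability U R) : Prop :=
  measurable_fun setT X /\
  forall A, measurable A -> P (X @^-1` A) = mu A.

Definition generated_sigma d d' (T : measurableType d) (U : measurableType d')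
    (I : Type) (X : I -> T -> U) : set_system T :=
  <<s \bigcup_i g_sigma_algebra_preimage (X i) >>.

Definition independent2 d (T : measurableType d) (P : probability T R)
    (F G : set_system T) : Prop :=
  forall A B, F A -> G B -> P (A `&` B) = (P A * P B)%E.

Definition mutually_independent d (T : measurableType d)
    (P : probability T R) (I : choiceType) (F : I -> set_system T) : Prop :=
  forall (J : {fset I}) (A : I -> set T), (forall i, i \in J -> F i (A i)) ->
    P (\bigcap_(i in [set` J]) A i) = (\prod_(i <- J) P (A i))%E.

Definition uniform_on d d' (T : measurableType d) (U : measurableType d')
    (P : probability T R) (X : T -> U) (A : set U) : Prop :=
  forall x, P (X @^-1` [set x]) =
    (if x \in A then (#|` fset_set A|%:R)^-1 else 0)%:E.

Definition geometric_law d (T : measurableType d) (P : probability T R)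
    (n : T -> nat) (p : R) : Prop :=
  forall j, P (n @^-1` [set j]) = (p * (1 - p) ^+ j)%:E.

Definition ring_count (C : set R) (a b : R) : nat :=
  #|` fset_set (C `&` `[a, b[)|.

(* A Poisson process on [0, +oo[ is given by the random set [C w] of its
   points: locally finite, with independent Poisson increments. *)
Definition poisson_process d (T : measurableType d) (P : probability T R)
    (rate : R) (C : T -> set R) : Prop :=
  [/\ forall w s, C w s -> 0 <= s,
      forall w t, finite_set (C w `&` `[0, t]),
      forall a b, measurable_fun setT (fun w => ring_count (C w) a b),
      forall a b k, 0 <= a < b ->
        P [set w | ring_count (C w) a b = k] =
        (poisson_pmf (rate * (b - a)) k)%:E &
      forall t : nat -> R, 0 <= t 0%N -> nondecreasing_seq t ->
        mutually_independent P (fun i =>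
          g_sigma_algebra_preimage
            (fun w => ring_count (C w) (t i) (t i.+1)))].

Definition clock_sigma d (T : measurableType d) (C : T -> set R)
    : set_system T :=
  generated_sigma (fun (ab : R * R) w => ring_count (C w) ab.1 ab.2).

Definition tight d (disp : nat -> measure_display)
    (T : forall N, measurableType (disp N)) (P : forall N, probability (T N) R)
    (D : set nat) (X : forall N, T N -> config d) : Prop :=
  forall eps : R, 0 < eps ->
    exists2 K : set (config d), compact K &
      forall N, D N -> (P N (X N @^-1` (~` K)) <= eps%:E)%E.

Definition weakly_converges d (disp : nat -> measure_display)
    (T : forall k, measurableType (disp k)) (P : forall k, probability (T k) R)
    (X : forall k, T k -> config d) (mu : probability (config d) R) : Prop :=
  forall g : config d -> R, continuous g ->
    (exists M : R, forall h, `|g h| <= M) ->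
    (fun k => \int[P k]_w (g (X k w))%:E)%E @ \oo --> (\int[mu]_h (g h)%:E)%E.

Definition much_less (a b : nat -> R) : Prop :=
  (fun N => a N / b N) @ \oo --> (0 : R).

End probability.

Definition deposit d (h : config d) (x : site d) : int :=
  \big[Num.max/ (h x : int) + 1]_(i < d)
    Num.max (h (x + basis_vec i) : int) (h (x - basis_vec i) : int).

(* All sites of [A] are updated simultaneously; a single update at [x] is the
   case [A = [set x]] *)
Definition update d (A : set (site d)) (h : config d) : config d :=
  fun x => if x \in A then deposit h x else h x.

Definition recenter d (h : config d) : config d :=
  fun x => (h x : int) - (h 0 : int).

Definition box d (N : nat) : set (site d) :=
  [set x | forall i, `|x 0 i| <= N%:Z].
Arguments box : clear implicits.

(* [s n] is the site updated at time [n] *)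
Fixpoint discrete_bd d (s : nat -> site d) (n : nat) : config d :=
  if n is m.+1 then update [set s m] (discrete_bd s m) else fun=> 0.

Section continuous_time.
Context {R : realType} {d : nat}.

(* In this section [c x] is the set of ringing times at the site [x], for one
   realization of the clocks. *)
(* Since [h(s, x)] takes its new value only for s > t when the clock rings at
   time t, [h(t, .)] only depends on the rings at times s < t. *)
Definition ring_times (c : site d -> set R) (D : {fset site d}) (t : R) : seq R :=
  sort <=%O (fset_set [set s | 0 <= s < t /\ exists2 x, x \in D & c x s]).

(* The process which performs only the updates at sites of [D], in temporal
   order. Rings at exactly the same time at distinct sites (an event of
   probability 0 for independent Poisson clocks) are treated simultaneously. *)
Definition finite_bd (c : site d -> set R) (D : {fset site d})
    (h0 : config d) (t : R) : config d :=
  foldl (fun h s => update [set x | x \in D /\ c x s] h) h0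
    (ring_times c D t).

(* The limit, in the discrete space Z, of the nondecreasing net
   [finite_bd c D h0 t x] as the finite set [D] increases to Z^d; it takes the
   irrelevant value 0 if the net diverges to +oo. *)
Definition continuous_bd (c : site d -> set R) (h0 : config d) (t : R)
    : config d :=
  fun x => xget (0 : int) [set v | exists D0 : {fset site d},
    forall D : {fset site d}, (D0 `<=` D)%fset -> finite_bd c D h0 t x = v].

End continuous_time.

(* Case t = 0 forces [h 0 = 0] for [mu]-almost every [h], so that [h0] is then
   almost surely equal to the initial value [recenter h0] of the Markov
   process. *)
Definition stationary {R : realType} d (mu : probability (config d) R)
    : Prop :=
  forall (disp : measure_display) (T : measurableType disp)
    (P : probability T R) (C : site d -> T -> set R) (h0 : T -> config d),
  (forall x, poisson_process P 1 (C x)) ->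
  mutually_independent P (fun x => clock_sigma (C x)) ->
  has_law P h0 mu ->
  independent2 P (g_sigma_algebra_preimage h0)
    <<s \bigcup_x clock_sigma (C x) >> ->
  forall t : R, 0 <= t ->
    has_law P (fun w => recenter (continuous_bd (C^~ w) (h0 w) t)) mu.

(* Main.v *)
(* Let U_x be the update at x. The argument has two parts.

   At a geometric time n, summation by parts bounds the mean increment
   E[F(f(n+1)) - F(f(n))] of an observable F: it is at most p if 0 <= F <= 1,
   and at most of order 1/|B_N| + p if F = f(., x), because exponential moments
   show that the mean height grows at most linearly in n/|B_N|. In the second
   case the increment is E[max(1, max_y (f(y) - f(x)))]/|B_N|, so that
   p|B_N| = O(1) bounds E|f(x) - f(y)| for neighbours x, y uniformly in N; this
   is tightness. In the first case p|B_N| -> 0 yields, for a weak limit mu and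
   every local event B invariant under vertical shifts, the identity
   sum_x (mu(U_x^-1 B) - mu(B)) = 0.

   To pass to continuous time, cut [0, t] into m intervals. If no interval
   contains two rings in the box D, the process restricted to D is a product of
   U_x's, and its law is the m-th power of 1 + (t/m) sum_{x in D} (U_x - 1) up
   to O(1/m). Along these powers the dependence of an event on the height at y
   decays geometrically in |y|, hence the sites just outside of D = [-M, M]^d
   contribute an error that vanishes as M -> oo. This gives approximate
   invariance of mu under the dynamics in large boxes. The same error bound
   shows that the heights in boxes are tight; being monotone in the box, they
   converge almost surely, and the limit inherits the invariance. *)
Require Import Defs.
From HB Require Import structures.
From mathcomp Require Import all_boot all_order all_algebra finmap.
From mathcomp Require Import all_classical all_reals all_analysis.
From mathcomp Require Import measurable_realfun ring lra zify.

Set Implicit Arguments.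
Unset Strict Implicit.
Unset Printing Implicit Defensive.
Import Order.TTheory GRing.Theory Num.Theory.
Import numFieldNormedType.Exports.
Local Open Scope classical_set_scope.
Local Open Scope ring_scope.

(** * Deposition at a single site *)

(** The estimates at the geometric time concern [f], while [u] is pinned at the origin and an update
    at 0 destroys the pinning. Shift-invariant events do not distinguish [f] from [u], and preimages
    under updates keep them shift-invariant; this is why the generator identity is stated for them.
    The pinning of [mu] comes back only in the last step. The obstacle is to pass from an
    infinitesimal identity to invariance: the rates sum to infinity over Z^d, so no semigroup in
    infinite volume is at hand, and [mu] is not invariant for the dynamics frozen outside a box.
    What is exact is that an Euler step in [boxf M.+1] preserves the [mu]-mean of a shift-invariant
    cylinder function of the heights in [boxf M.+1]. The iterates of the step in [boxf M] are such
    functions, so each step loses only the sites of norm [M.+1]. Mean heights are never integrals of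
    unbounded variables: [expect] is an iterated finite average and [geo] a truncated geometric sum.
    The bounds are uniform in the truncation, which is removed for indicators only. *)

Lemma config_eq d (h h' : config d) : (forall x, h x = h' x) -> h = h'.
Proof. by move=> e; apply: functional_extensionality_dep. Qed.

Definition nbrs d (x : site d) : seq (site d) :=
  [seq x + basis_vec i | i : 'I_d] ++ [seq x - basis_vec i | i : 'I_d].

Lemma nbrsP d (x y : site d) :
  reflect (exists i, y = x + basis_vec i \/ y = x - basis_vec i) (y \in nbrs x).
Proof.
rewrite mem_cat; apply: (iffP orP) => [[] /mapP[i _ ->]|[i [->|->]]].
- by exists i; left.
- by exists i; right.
- by left; apply/mapP; exists i => //; rewrite mem_enum.
- by right; apply/mapP; exists i => //; rewrite mem_enum.
Qed.

Lemma nbrs_sym d (x y : site d) : (y \in nbrs x) = (x \in nbrs y).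
Proof.
by apply/nbrsP/nbrsP => -[i [->|->]]; exists i; [right|left|right|left];
  rewrite ?addrK ?subrK.
Qed.

Lemma size_nbrs d (x : site d) : size (nbrs x) = (2 * d)%N.
Proof. by rewrite size_cat !size_image card_ord mul2n addnn. Qed.

Lemma nbrs_irr d (x : site d) : x \notin nbrs x.
Proof.
have b0 i : basis_vec i <> 0 :> site d.
  by move=> /matrixP /(_ 0 i); rewrite !mxE !eqxx.
apply/negP => /nbrsP[i [|]] /eqP.
  by rewrite -{1}[x]addr0 (inj_eq (addrI x)) eq_sym => /eqP/b0.
by rewrite -{1}[x]addr0 (inj_eq (addrI x)) eq_sym oppr_eq0 => /eqP/b0.
Qed.

Section deposit.
Context {d : nat}.
Implicit Types (h : config d) (x y : site d).

Lemma deposit_leP h x (v : int) : reflect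
  ((h x : int) + 1 <= v /\ forall y, y \in nbrs x -> (h y : int) <= v)
  (deposit h x <= v).
Proof.
rewrite /deposit; apply: (iffP idP).
  move=> /bigmax_leP[h1 h2]; split => // y /nbrsP[i Hi].
  have := h2 i isT; rewrite ge_max => /andP[l1 l2].
  by case: Hi => ->.
move=> [h1 h2]; apply/bigmax_leP; split => // i _.
by rewrite ge_max !h2 //; apply/nbrsP; exists i; [right|left].
Qed.

Lemma deposit_self h x : (h x : int) + 1 <= deposit h x.
Proof. by have /deposit_leP[] := lexx (deposit h x). Qed.

Lemma deposit_nbr h x y : y \in nbrs x -> (h y : int) <= deposit h x.
Proof. by move=> xy; have /deposit_leP[_ ->] := lexx (deposit h x). Qed.

Lemma deposit_attained h x :
  deposit h x = (h x : int) + 1 \/ exists2 y, y \in nbrs x & deposit h x = h y.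
Proof.
pose p v := v = (h x : int) + 1 \/ exists2 y, y \in nbrs x & v = (h y : int).
rewrite -/(p (deposit h x)) /deposit.
elim/big_ind: _ => [|u v pu pv|i _]; first by left.
  by rewrite /Num.max; case: ifP.
rewrite /Num.max; case: ifP => _; right.
  by exists (x - basis_vec i) => //; apply/nbrsP; exists i; right.
by exists (x + basis_vec i) => //; apply/nbrsP; exists i; left.
Qed.

Lemma le_deposit h h' x : (forall y, (h y : int) <= h' y) ->
  deposit h x <= deposit h' x.
Proof.
move=> hh'; apply/deposit_leP; split => [|y xy].
  by rewrite (le_trans _ (deposit_self h' x)) ?lerD2r.
exact: le_trans (hh' y) (deposit_nbr _ xy).
Qed.

Lemma eq_deposit h h' x :
  h x = h' x -> (forall y, y \in nbrs x -> h y = h' y) ->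
  deposit h x = deposit h' x.
Proof.
move=> ex en; apply/eqP; rewrite eq_le; apply/andP.
split; apply/deposit_leP; split.
- by rewrite ex deposit_self.
- by move=> y xy; rewrite en ?deposit_nbr.
- by rewrite -ex deposit_self.
- by move=> y xy; rewrite -en ?deposit_nbr.
Qed.

Definition raise (c : int) h : config d := fun x => (h x : int) + c.

Lemma deposit_raise c h x : deposit (raise c h) x = deposit h x + c.
Proof.
apply/eqP; rewrite eq_le; apply/andP; split.
  apply/deposit_leP; split; first by rewrite addrAC lerD2r deposit_self.
  by move=> y xy; rewrite lerD2r deposit_nbr.
rewrite -lerBrDr; apply/deposit_leP; split.
  by rewrite lerBrDr addrAC (deposit_self (raise c h)).
by move=> y xy; rewrite lerBrDr (deposit_nbr (raise c h)).
Qed.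

Definition drop_at x h : config d := update [set x] h.

Lemma dropE x h y : drop_at x h y = if y == x then deposit h x else h y.
Proof.
rewrite /drop_at /update; case: (eqVneq y x) => [->|yx].
  by rewrite ifT // inE.
by rewrite ifF //; apply/negP; rewrite inE /= => /eqP; rewrite (negbTE yx).
Qed.

Lemma drop_same x h : drop_at x h x = deposit h x.
Proof. by rewrite dropE eqxx. Qed.

Lemma drop_other x h y : y != x -> drop_at x h y = h y.
Proof. by rewrite dropE => /negbTE ->. Qed.

Lemma drop_raise c x h : drop_at x (raise c h) = raise c (drop_at x h).
Proof.
apply: config_eq => y; rewrite /raise !dropE.
by case: eqP => // _; rewrite -/(raise c h) deposit_raise.
Qed.

Lemma recenter_raise c h : recenter (raise c h) = recenter h.
Proof.
by apply: config_eq => y; rewrite /recenter /raise opprD addrACA subrr addr0.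
Qed.

Lemma update_set0 h : update set0 h = h.
Proof. by apply: config_eq => x; rewrite /update ifF // in_set0. Qed.

(** A deposition never lowers a height, so enlarging the set of updated sites can only raise the
    result. This is the source of the monotonicity of finite volume heights in the box. *)
Lemma le_update (A A' : set (site d)) h h' : A `<=` A' ->
  (forall x, (h x : int) <= h' x) ->
  forall x, (update A h x : int) <= update A' h' x.
Proof.
move=> AA' hh' x; rewrite /update; case: ifPn => xA.
  by rewrite ifT ?le_deposit // inE; apply: AA'; rewrite inE in xA.
case: ifPn => // _; apply: le_trans (hh' x) _.
by rewrite (le_trans _ (deposit_self _ _)) // lerDl.
Qed.

End deposit.

(** * Sup norm and boxes *)

Section norm.
Context {d : nat}.
Implicit Types (x y : site d).

Definition snorm x : nat := (\max_(i < d) absz (x ord0 i))%N.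

Lemma snorm_leP x n : reflect (forall i, (absz (x ord0 i) <= n)%N) (snorm x <= n)%N.
Proof.
by apply: (iffP (bigmax_leqP xpredT n _)) => [H i|H i _]; exact: H.
Qed.

Lemma snorm0 : snorm 0 = 0%N.
Proof. by apply/eqP; rewrite -leqn0; apply/snorm_leP => i; rewrite mxE. Qed.

Lemma snorm_nbr x y : y \in nbrs x -> (snorm y <= (snorm x).+1)%N.
Proof.
move=> /nbrsP[i xy]; apply/snorm_leP => j.
have hj : (absz (x ord0 j) <= snorm x)%N by exact/snorm_leP.
have hb : (absz ((basis_vec i : site d) ord0 j) <= 1)%N.
  by rewrite /basis_vec mxE eqxx; case: (_ == _).
have hD (u v : site d) : (absz ((u + v)%R ord0 j) <= absz (u ord0 j) + absz (v ord0 j))%N.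
  by rewrite mxE -lez_nat PoszD !abszE ler_normD.
have hN (u : site d) : absz ((- u)%R ord0 j) = absz (u ord0 j) by rewrite mxE abszN.
by case: xy => ->; apply: leq_trans (hD _ _) _; rewrite ?hN -[(snorm x).+1]addn1 leq_add.
Qed.

Lemma boxE N x : box d N x = (snorm x <= N)%N :> Prop.
Proof.
apply/propext; split=> [bx|/snorm_leP bx].
  by apply/snorm_leP => i; have := bx i; rewrite -lez_nat abszE.
by move=> i; rewrite -abszE lez_nat.
Qed.

End norm.

Section box_fset.
Context {d : nat}.

(** Presenting the box as an image of a finite function space gives its finiteness and its
    cardinality bound at once. *)
Definition box_point (N : nat) (f : {ffun 'I_d -> 'I_(2 * N).+1}) : site d :=
  \row_i ((f i : nat)%:Z - N%:Z).

Definition boxf (N : nat) : {fset site d} :=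
  [fset box_point f | f : {ffun 'I_d -> 'I_(2 * N).+1}]%fset.

Lemma in_boxf N x : (x \in boxf N) = (snorm x <= N)%N.
Proof.
apply/imfsetP/idP => [[f _ ->]|/snorm_leP xN].
  apply/snorm_leP => i; rewrite mxE; move: (ltn_ord (f i)); clear; move: (nat_of_ord _) => k; lia.
have lx i : (absz (x ord0 i + N%:Z)%R < (2 * N).+1)%N.
  by move: (xN i); clear; move: (x _ _) => k; lia.
exists [ffun i => Ordinal (lx i)] => //.
apply/rowP => i; rewrite mxE ffunE /=; move: (xN i); clear; move: (x _ _) => k; lia.
Qed.

Lemma card_boxf N : (#|` boxf N| <= (2 * N).+1 ^ d)%N.
Proof.
apply: leq_trans (leq_imfset_card _ _ _) _.
by rewrite -cardE card_ffun !card_ord.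
Qed.

Lemma box_boxf N : box d N = [set` boxf N].
Proof. by apply/seteqP; split => x; rewrite boxE /= in_boxf. Qed.

Lemma fset_set_box N : fset_set (box d N) = boxf N.
Proof. by rewrite box_boxf set_fsetK. Qed.

Lemma mem_box N x : (x \in box d N) = (x \in boxf N).
Proof. by apply/idP/idP; rewrite inE box_boxf. Qed.

Lemma card_boxf_gt0 N : (0 < #|` boxf N|)%N.
Proof. by rewrite cardfs_gt0; apply/fset0Pn; exists 0; rewrite in_boxf snorm0. Qed.

Lemma boxf_sub M N : (M <= N)%N -> (boxf M `<=` boxf N)%fset.
Proof. by move=> MN; apply/fsubsetP => x; rewrite !in_boxf => /leq_trans ->. Qed.

Lemma fset_sub_boxf (D : {fset site d}) : exists M, (D `<=` boxf M)%fset.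
Proof.
exists (\max_(x <- D) snorm x)%N; apply/fsubsetP => x xD.
by rewrite in_boxf (leq_bigmax_seq (F := @snorm d)).
Qed.

End box_fset.

(** * Euler steps of the generator and decay of influence *)

Section generator.
Context {R : realType} {d : nat}.
Implicit Types (G H : config d -> R) (h : config d) (x y : site d) (D : {fset site d}).

Definition agree_off y h h' := forall z, z != y -> h z = h' z.

(** The sitewise oscillation used for interacting particle systems: [a y] measures the influence of
    the height at [y] on [G]. *)
Definition osc_le G (a : site d -> R) :=
  forall y h h', agree_off y h h' -> `|G h - G h'| <= a y.

Definition localn M G :=
  forall h h', (forall z, (snorm z <= M)%N -> h z = h' z) -> G h = G h'.

(* The Euler step [1 + e L] of the generator [L G = sum_x (G o drop_at x - G)]. *)
Definition step (e : R) D G : config d -> R :=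
  fun h => G h + e * \sum_(x <- D) (G (drop_at x h) - G h).

(* A deposition at [x] adds to the oscillation at [y] at most that at a
   neighbour [x] of [y]; a geometric profile is a supersolution of this linear
   recursion. *)
Definition decay (q c : R) : site d -> R := fun y => c * q ^- snorm y.

(** When [e] times |D| is at most 1 the weights are nonnegative and sum to 1, so [step] is a Markov
    operator. Contraction and oscillation bounds are read off this form. *)
Lemma stepE e D G h :
  step e D G h = (1 - e * #|` D|%:R) * G h + e * \sum_(x <- D) G (drop_at x h).
Proof.
rewrite /step big_split /= sumrN big_const_seq count_predT iter_addr_0.
by rewrite mulrDr mulrBl mul1r mulrN -[_ *+ size _]mulr_natl mulrA; ring.
Qed.

Lemma localn_drop_out M G x h : localn M G -> (M < snorm x)%N ->
  G (drop_at x h) = G h.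
Proof.
move=> lG Mx; apply: lG => z zM; apply: drop_other.
by apply: contraTneq zM => ->; rewrite -ltnNge.
Qed.

Lemma localn_le M N G : (M <= N)%N -> localn M G -> localn N G.
Proof. by move=> MN lG h h' hh'; apply: lG => z /leq_trans/(_ MN)/hh'. Qed.

(** An update at a site of norm at most [M] reads only heights of norm at most [M.+1]; hence
    iterating updates inside [boxf M] never enlarges the radius [M.+1]. *)
Lemma localn_drop M G x : (snorm x <= M)%N -> localn M.+1 G ->
  localn M.+1 (G \o drop_at x).
Proof.
move=> xM lG h h' hh' /=; apply: lG => z zM; rewrite !dropE.
case: eqP => // _; last exact: hh'.
apply: eq_deposit => [|y xy]; apply: hh'; first exact: leq_trans xM _.
exact: leq_trans (snorm_nbr xy) _.
Qed.

Lemma localn_step e M D G : (D `<=` boxf M)%fset -> localn M.+1 G ->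
  localn M.+1 (step e D G).
Proof.
move=> /fsubsetP DM lG h h' hh'; rewrite /step (lG _ _ hh'); congr (_ + _ * _).
rewrite !big_seq; apply: eq_bigr => x /DM; rewrite in_boxf => xM.
by have /= -> := localn_drop xM lG hh'.
Qed.

Lemma localn_iter_step e M D G k : (D `<=` boxf M)%fset -> localn M.+1 G ->
  localn M.+1 (iter k (step e D) G).
Proof. by move=> DM lG; elim: k => //= k; exact: localn_step. Qed.

Lemma osc_drop G a x h : osc_le G a -> `|G (drop_at x h) - G h| <= a x.
Proof. by move=> oG; apply: oG => z; exact: drop_other. Qed.

Section osc_step.
Variable q : R.
Hypothesis q1 : 1 <= q.

Let q0 : 0 < q. Proof. exact: lt_le_trans q1. Qed.

Lemma decay_ge0 c y : 0 <= c -> 0 <= decay q c y.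
Proof. by move=> c0; rewrite mulr_ge0 // invr_ge0 exprn_ge0 // ltW. Qed.

Lemma decay_nbr c x y : 0 <= c -> y \in nbrs x -> decay q c y <= q * decay q c x.
Proof.
rewrite nbrs_sym => c0 /snorm_nbr xy; rewrite /decay mulrCA ler_wpM2l //.
rewrite ler_pdivlMr ?exprn_gt0 // mulrC ler_pdivrMr ?exprn_gt0 // -exprS.
by rewrite ler_weXn2l.
Qed.

(** A deposition at [x] spreads a discrepancy at [y] to another site only if [x] is a neighbour of
    [y], and then only to [x]. *)
Lemma osc_drop2 G c x y h h' : osc_le G (decay q c) -> 0 <= c ->
  agree_off y h h' ->
  `|G (drop_at x h) - G (drop_at x h')|
    <= decay q c y + (if x \in nbrs y then q * decay q c y else 0).
Proof.
move=> oG c0 hh'; have [->|xy] := eqVneq x y.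
  rewrite (negbTE (nbrs_irr y)) addr0; apply: oG => z zy.
  by rewrite !drop_other // hh'.
case: ifPn => xny; last first.
  rewrite addr0; apply: oG => z zy; rewrite !dropE; case: eqP => // [_|_].
    apply: eq_deposit => [|u]; first exact: hh'.
    rewrite nbrs_sym => xu; apply: hh'.
    by apply: contraNneq xny => <-.
  exact: hh'.
(* [k] interpolates between the two results, so that the discrepancies at [x] and at [y] are changed
   one at a time. *)
pose k : config d := fun z => if z == x then drop_at x h' x else drop_at x h z.
rewrite [leRHS]addrC; apply: le_trans (ler_distD (G k) _ _) _; apply: lerD.
  apply: le_trans (decay_nbr c0 xny).
  by apply: oG => z zx; rewrite /k (negbTE zx).
apply: oG => z zy; rewrite /k; case: eqP => [->//|/eqP zx].
by rewrite !drop_other // hh'.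
Qed.

(** Each [x] in [D] contributes the old oscillation at [y], which compensates the loss of weight of
    [G h]. What remains comes from the at most [2 * d] neighbours of [y], each with a factor [q]. *)
Lemma osc_step e D G c : 0 <= e -> e * #|` D|%:R <= 1 -> 0 <= c ->
  osc_le G (decay q c) ->
  osc_le (step e D G) (decay q (c * (1 + e * (2 * d)%:R * q))).
Proof.
move=> e0 eD c0 oG y h h' hh'; rewrite !stepE opprD addrACA -!mulrBr.
rewrite -sumrB (le_trans (ler_normD _ _)) // !normrM.
rewrite (ger0_norm e0) ger0_norm ?subr_ge0 //.
have S : `|\sum_(x <- D) (G (drop_at x h) - G (drop_at x h'))| <=
    #|` D|%:R * decay q c y + (2 * d)%:R * (q * decay q c y).
  apply: le_trans (ler_norm_sum _ _ _) _.
  apply: le_trans (ler_sum _ _) _; first by move=> x _; exact: osc_drop2 oG c0 hh'.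
  rewrite big_split /= big_const_seq count_predT iter_addr_0 mulr_natl lerD2l.
  rewrite -big_mkcond big_const_seq iter_addr_0 -[leLHS]mulr_natl ler_wpM2r //.
    by rewrite mulr_ge0 ?decay_ge0 // ltW.
  rewrite ler_nat -(size_nbrs y) -size_filter uniq_leq_size ?filter_uniq ?fset_uniq //.
  by move=> x; rewrite mem_filter => /andP[].
apply: le_trans (lerD (ler_wpM2l _ (oG _ _ _ hh')) (ler_wpM2l e0 S)) _.
  by rewrite subr_ge0.
rewrite le_eqVlt; apply/orP; left; apply/eqP; rewrite /decay; ring.
Qed.

Lemma osc_iter_step e D G c k : 0 <= e -> e * #|` D|%:R <= 1 -> 0 <= c ->
  osc_le G (decay q c) ->
  osc_le (iter k (step e D) G) (decay q (c * (1 + e * (2 * d)%:R * q) ^+ k)).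
Proof.
move=> e0 eD c0 oG; elim: k => [|k IH]; first by rewrite mulr1.
rewrite exprSr mulrA iterS; apply: osc_step => //.
by rewrite mulr_ge0 // exprn_ge0 // addr_ge0 // !mulr_ge0 // ltW.
Qed.

(** Sites of norm above [M.+1] are invisible to [G]. The sites of norm exactly [M.+1] are counted
    crudely by the whole of [boxf M.+1]. *)
Lemma step_subset e M D G c h : 0 <= e -> 0 <= c -> (boxf M `<=` D)%fset ->
  localn M.+1 G -> osc_le G (decay q c) ->
  `|step e D G h - step e (boxf M) G h|
     <= e * (((2 * M.+1).+1 ^ d)%:R * (c * q ^- M.+1)).
Proof.
move=> e0 c0 MD lG oG; rewrite /step opprD addrACA subrr add0r -mulrBr normrM.
rewrite (ger0_norm e0) ler_wpM2l //.
rewrite (big_fsetID _ (mem (boxf M))) /=.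
have -> : [fset x in D | x \in boxf M]%fset = boxf M.
  apply/fsetP => x; rewrite !inE /= andbC; case: (boolP (x \in boxf M)) => //=.
  by move/fsubsetP: MD; exact.
rewrite [X in `|X|]addrAC [X in `|X + _|]subrr add0r.
apply: le_trans (ler_norm_sum _ _ _) _.
rewrite (bigID (fun x => x \in boxf M.+1)) /= [X in _ + X]big1_seq ?addr0; last first.
  move=> x /andP[]; rewrite in_boxf -ltnNge => xM _.
  by rewrite (localn_drop_out _ lG xM) subrr normr0.
rewrite big_seq_cond.
apply: le_trans (@ler_sum _ _ _ _ _ (fun=> c * q ^- M.+1) _) _.
  move=> x /andP[]; rewrite !inE /= !in_boxf -ltnNge => /andP[_ Mx] xM.
  have -> : M.+1 = snorm x by apply/eqP; rewrite eqn_leq Mx xM.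
  exact: (osc_drop x h oG).
rewrite -big_seq_cond big_const_seq iter_addr_0 -[leLHS]mulr_natl ler_wpM2r //.
  by rewrite mulr_ge0 // invr_ge0 exprn_ge0 // ltW.
rewrite ler_nat; apply: leq_trans (card_boxf M.+1).
rewrite -size_filter uniq_leq_size ?filter_uniq ?fset_uniq //.
by move=> x; rewrite mem_filter => /andP[].
Qed.

End osc_step.

Lemma step_norm e D G c : 0 <= e -> e * #|` D|%:R <= 1 ->
  (forall h, `|G h| <= c) -> forall h, `|step e D G h| <= c.
Proof.
move=> e0 eD Gc h; rewrite stepE (le_trans (ler_normD _ _)) // !normrM.
rewrite (ger0_norm e0) ger0_norm ?subr_ge0 //.
have S : `|\sum_(x <- D) G (drop_at x h)| <= #|` D|%:R * c.
  apply: le_trans (ler_norm_sum _ _ _) _.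
  apply: le_trans (ler_sum _ (fun x _ => Gc _)) _.
  by rewrite big_const_seq count_predT iter_addr_0 mulr_natl.
apply: le_trans (lerD (ler_wpM2l _ (Gc _)) (ler_wpM2l e0 S)) _.
  by rewrite subr_ge0.
by rewrite le_eqVlt; apply/orP; left; apply/eqP; ring.
Qed.

Lemma iter_step_norm e D G c k : 0 <= e -> e * #|` D|%:R <= 1 ->
  (forall h, `|G h| <= c) -> forall h, `|iter k (step e D) G h| <= c.
Proof. by move=> e0 eD Gc; elim: k => //= k; exact: step_norm. Qed.

Lemma step_contract e D G H c : 0 <= e -> e * #|` D|%:R <= 1 ->
  (forall h, `|G h - H h| <= c) ->
  forall h, `|step e D G h - step e D H h| <= c.
Proof.
move=> e0 eD GH h; have -> : step e D G h - step e D H h =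
    step e D (fun h => G h - H h) h.
  by rewrite !stepE sumrB; ring.
exact: (step_norm e0 eD GH).
Qed.

(* A contraction [A] is compared with [B] by interpolating between [A^m] and
   [B^m] one factor at a time. *)
Lemma iter_compare (A B : (config d -> R) -> config d -> R) G (e : R) m :
  (forall G1 G2 c, (forall h, `|G1 h - G2 h| <= c) ->
     forall h, `|A G1 h - A G2 h| <= c) ->
  (forall k, (k < m)%N -> forall h, `|A (iter k B G) h - B (iter k B G) h| <= e) ->
  forall h, `|iter m A G h - iter m B G h| <= m%:R * e.
Proof.
move=> cA; elim: m => [|m IH] AB h; first by rewrite /= subrr normr0 mul0r.
rewrite !iterS; apply: le_trans (ler_distD (A (iter m B G) h) _ _) _.
rewrite -natr1 mulrDl mul1r lerD //; last exact: AB.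
by apply: cA => h'; apply: IH => k km; apply: AB; exact: leq_trans km _.
Qed.

End generator.

(** * Local events and the Borel sigma-algebra *)

Section countable_measurability.
Context {disp : measure_display} {T : measurableType disp} {I : countType}.

Lemma bigcup_countType_measurable (D : set I) (F : I -> set T) :
  (forall i, D i -> measurable (F i)) -> measurable (\bigcup_(i in D) F i).
Proof.
move=> mF; rewrite bigcup_mkcond; apply: countable_bigcupT_measurable => [|i].
  exact: countableP.
by case: ifPn => // iD; apply: mF; rewrite inE in iD.
Qed.

Lemma bigcap_countType_measurable (D : set I) (F : I -> set T) :
  (forall i, D i -> measurable (F i)) -> measurable (\bigcap_(i in D) F i).
Proof.
move=> mF; rewrite -[X in measurable X]setCK setC_bigcap; apply: measurableC.
by apply: bigcup_countType_measurable => i /mF; exact: measurableC.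
Qed.

End countable_measurability.

Section local_sets.
Context {d : nat}.
Implicit Types (h : config d) (B : set (config d)).

Definition local M B := forall h h' : config d,
  (forall z, (snorm z <= M)%N -> h z = h' z) -> B h -> B h'.

Lemma local_le M N B : (M <= N)%N -> local M B -> local N B.
Proof. by move=> MN lB h h' hh'; apply: lB => z /leq_trans/(_ MN)/hh'. Qed.

Lemma localI M B B' : local M B -> local M B' -> local M (B `&` B').
Proof.
by move=> lB lB' h h' hh' [Bh B'h]; split; [exact: lB Bh|exact: lB' B'h].
Qed.

Lemma local_site M x (Q : set int) : (snorm x <= M)%N ->
  local M [set h | Q (h x)].
Proof. by move=> xM h h' /(_ x xM) /= ->. Qed.

Lemma local_recenter M B : local M B -> local M (@recenter d @^-1` B).
Proof.
move=> lB h h' hh'; apply: lB => z zM.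
by rewrite /recenter !hh' // snorm0.
Qed.

Lemma local_drop M B x : (snorm x <= M)%N -> local M.+1 B ->
  local M.+1 (drop_at x @^-1` B).
Proof.
move=> xM lG h h' hh' /=; apply: lG => z zM; rewrite !dropE.
case: eqP => // _; last exact: hh'.
apply: eq_deposit => [|y xy]; apply: hh'; first exact: leq_trans xM _.
exact: leq_trans (snorm_nbr xy) _.
Qed.

Lemma nbhs_site h x : nbhs h [set h' : config d | h' x = h x].
Proof.
have := @proj_continuous (site d) (fun=> discrete_topology int) x h [set h x].
by apply; exact: discrete_set1.
Qed.

Lemma nbhs_boxf h M :
  nbhs h [set h' : config d | forall z, (snorm z <= M)%N -> h z = h' z].
Proof.
have : nbhs h (\bigcap_(z in [set` boxf M]) [set h' : config d | h' z = h z]).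
  by apply: filter_bigI => z _; exact: nbhs_site.
by apply: filterS => h' H z zM; rewrite (H z) //= in_boxf.
Qed.

Lemma local_open M B : local M B -> open B.
Proof.
move=> lB; rewrite openE => h Bh; apply: filterS (nbhs_boxf h M) => h' hh'.
exact: lB Bh.
Qed.

Lemma local_measurable M B : local M B -> measurable B.
Proof. by move=> /local_open oB; exact: sub_sigma_algebra. Qed.

(** The largest event of radius [M] contained in [B]. *)
Definition local_interior M B : set (config d) :=
  [set h | forall h', (forall z, (snorm z <= M)%N -> h z = h' z) -> B h'].

Lemma local_local_interior M B : local M (local_interior M B).
Proof.
by move=> h h' hh' Bh k h'k; apply: Bh => z zM; rewrite hh' // h'k.
Qed.

(** If no box certified that [h] lies in [B], there would be points outside [B] agreeing with [h] on
    larger and larger boxes; they converge to [h] pointwise, against openness. *)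
Lemma open_local_interior B : open B -> B = \bigcup_M local_interior M B.
Proof.
move=> oB; apply/seteqP; split => [h Bh|h [M _]]; last exact.
apply: contrapT => /forallPNP H.
have /choice[k kP] : forall M, exists k : config d,
    (forall z, (snorm z <= M)%N -> h z = k z) /\ ~ B k.
  by move=> M; have /existsNP[k /not_implyP[]] := H M I; exists k.
have kh : k @ \oo --> h.
  apply/cvg_sup => x U [V] [[W oW <-] Wh VU].
  apply: (filterS VU); exists (snorm x) => // n /= xn.
  by rewrite /= -(kP n).1.
have : \forall n \near \oo, B (k n) by apply: kh; exact: open_nbhs_nbhs.
by move=> [n _ /(_ n (leqnn _))]; exact: (kP n).2.
Qed.

Lemma measurable_local_generated :
  @measurable _ (config d) = <<s [set B | exists M, local M B] >>.
Proof.
apply/seteqP; split; last first.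
  by apply: smallest_sub => [|B [M /local_measurable]//]; exact: sigma_algebra_measurable.
apply: smallest_sub; first exact: smallest_sigma_algebra.
move=> B /open_local_interior ->.
apply: (@bigcupT_measurable _ (g_sigma_algebraType [set B : set (config d) | exists M, local M B])).
move=> M; apply: sub_sigma_algebra; exists M; exact: local_local_interior.
Qed.

End local_sets.

Section measurable_config.
Context {d : nat} {disp : measure_display} {T : measurableType disp}.
Implicit Types (X : T -> config d) (B : set (config d)).

(** A local event is a union of cylinders coded by finite lists of pairs (site, height), and there
    are only countably many such lists. *)
Lemma measurable_preimage_local M X B :
  (forall x v, measurable [set w | X w x = v]) -> local M B ->
  measurable (X @^-1` B).
Proof.
move=> mX lB.
pose C (l : seq (site d * int)) := [set h : config d | forall p, p \in l -> h p.1 = p.2].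
have -> : X @^-1` B = \bigcup_(l in [set l | C l `<=` B]) (X @^-1` C l).
  apply/seteqP; split => [w Bw|w [l lB' Cw]]; last exact: lB'.
  exists [seq (x, X w x) | x <- boxf M]; last by move=> p /mapP[x _ ->].
  move=> h Ch; apply: lB Bw => z zM.
  apply/esym/(Ch (z, X w z))/mapP; exists z => //; by rewrite in_boxf.
apply: bigcup_countType_measurable => l _.
have -> : X @^-1` C l = \bigcap_(p in [set` l]) [set w | X w p.1 = p.2] by [].
by apply: bigcap_countType_measurable => p _; exact: mX.
Qed.

Lemma measurable_fun_config X :
  (forall x v, measurable [set w | X w x = v]) -> measurable_fun setT X.
Proof.
move=> mX; apply: (measurability (@open (config d))) => // _ [B oB <-].
rewrite setTI (open_local_interior oB) preimage_bigcup.
apply: bigcupT_measurable => M.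
exact: (measurable_preimage_local mX (@local_local_interior d M B)).
Qed.

Lemma measurable_fun_site X x v : measurable_fun setT X ->
  measurable [set w | X w x = v].
Proof.
have lx : local (snorm x) [set h : config d | h x = v].
  refine (local_site (Q:=[set v]) (leqnn (snorm x))).
move=> mX; rewrite -[X in measurable X]setTI.
exact: (mX measurableT _ (local_measurable lx)).
Qed.

End measurable_config.

Lemma measurable_recenter d : measurable_fun setT (@recenter d).
Proof.
apply: measurable_fun_config => x v.
have lx := local_recenter (local_site (Q:=[set v]) (leqnn (snorm x))).
exact: local_measurable lx.
Qed.

Lemma measurable_drop d (x : site d) : measurable_fun setT (drop_at x).
Proof.
apply: measurable_fun_config => y v.
have xM : (snorm x <= maxn (snorm x) (snorm y))%N by rewrite leq_maxl.
have yM : (snorm y <= (maxn (snorm x) (snorm y)).+1)%N by rewrite leqW // leq_maxr.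
exact: local_measurable (local_drop xM (local_site (Q:=[set v]) yM)).
Qed.

Lemma measurable_preimageT d1 d2 (T1 : measurableType d1) (T2 : measurableType d2)
  (f : T1 -> T2) (A : set T2) :
  measurable_fun setT f -> measurable A -> measurable (f @^-1` A).
Proof. by move=> mf mA; rewrite -[X in measurable X]setTI; exact: mf. Qed.

(** Local events are stable under intersection and generate the Borel sigma-algebra, so a
    probability measure is determined by them. *)
Lemma local_law_unique (R : realType) d disp (T : measurableType disp)
  (P : probability T R) (X : T -> config d) (mu : probability (config d) R) :
  measurable_fun setT X ->
  (forall M B, local M B -> P (X @^-1` B) = mu B) -> has_law P X mu.
Proof.
move=> mX XB; split; first exact: mX.
move=> A mA.
pose X' := mfun_Sub (mem_set mX : X \in mfun).
rewrite -[LHS]/(distribution P X' A).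
apply: (measure_unique [set B | exists M, local M B] (fun=> setT)) => //.
- exact: measurable_local_generated.
- move=> B B' [M lB] [M' lB']; exists (maxn M M').
  by apply: localI; [apply: local_le lB|apply: local_le lB']; rewrite ?leq_maxl ?leq_maxr.
- by move=> _; exists 0%N.
- by rewrite bigcup_const.
- by move=> B [M]; exact: XB.
- move=> _; apply: le_lt_trans (probability_le1 _ measurableT) _.
  exact: ltry.
Qed.

(** Heights are discrete, so a local event is clopen. Its indicator is therefore an admissible test
    function for weak convergence. *)
Lemma continuous_local (R : realType) d M (B : set (config d)) :
  local M B -> continuous (\1_B : config d -> R).
Proof.
move=> lB h U /nbhs_singleton Uh; change (nbhs h ((\1_B : config d -> R) @^-1` U)).
apply: filterS (nbhs_boxf h M) => h' hh'; rewrite /preimage /=.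
suff <- : \1_B h = \1_B h' :> R by [].
rewrite !indicE (_ : (h \in B) = (h' \in B)) //.
by apply/idP/idP; rewrite !inE; apply: lB => z /hh'.
Qed.

(** * Invariance under the generator *)

Section bounded_measurable.
Context {R : realType} {disp : measure_display} {T : measurableType disp}.
Implicit Types (P : probability T R) (f g : T -> R) (A : set T).

Definition pr P A : R := fine (P A).

Lemma prE P A : measurable A -> P A = (pr P A)%:E.
Proof. by move=> mA; rewrite /pr fineK // fin_num_measure. Qed.

Lemma pr_ge0 P A : 0 <= pr P A.
Proof. by rewrite fine_ge0 // measure_ge0. Qed.

Lemma pr_le P A B : measurable A -> measurable B -> A `<=` B -> pr P A <= pr P B.
Proof. by move=> mA mB AB; rewrite -lee_fin -!prE //; apply: le_measure; rewrite ?inE. Qed.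

Lemma pr_le1 P A : measurable A -> pr P A <= 1.
Proof. by move=> mA; rewrite -lee_fin -prE // probability_le1. Qed.

Lemma prT P : pr P setT = 1.
Proof. by rewrite /pr probability_setT. Qed.

Lemma prC P A : measurable A -> pr P (~` A) = 1 - pr P A.
Proof. by move=> mA; rewrite /pr probability_setC // fineB // fin_num_measure. Qed.

Definition bounded_mfun f := measurable_fun setT f /\ exists M, forall x, `|f x| <= M.

Lemma bmf_integrable P f : bounded_mfun f -> P.-integrable setT (EFin \o f).
Proof.
move=> [mf [M fM]]; apply: measurable_bounded_integrable => //.
  by apply: le_lt_trans (probability_le1 P measurableT) _; rewrite ltry.
exists M; split; rewrite ?num_real // => N MN x _.
exact: le_trans (fM x) (ltW MN).
Qed.

Lemma bmf_lin a f g : bounded_mfun f -> bounded_mfun g -> bounded_mfun (fun x => a * f x + g x).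
Proof.
move=> [mf [M fM]] [mg [N gN]]; split.
  by apply: measurable_funD => //; apply: measurable_funM.
exists (`|a| * M + N) => x; rewrite (le_trans (ler_normD _ _)) // lerD //.
by rewrite normrM ler_wpM2l.
Qed.

Lemma bmf_cst a : bounded_mfun (fun=> a).
Proof. by split => //; exists `|a|. Qed.

Lemma bmf_sum (I : Type) (s : seq I) (f : I -> T -> R) :
  (forall i, bounded_mfun (f i)) -> bounded_mfun (fun x => \sum_(i <- s) f i x).
Proof.
move=> bf; elim: s => [|i s IH].
  by under eq_fun do rewrite big_nil; exact: bmf_cst.
under eq_fun do rewrite big_cons -[f _ _]mul1r.
exact: bmf_lin.
Qed.

Lemma bmf_indic A : measurable A -> bounded_mfun (\1_A).
Proof.
move=> mA; split; first exact: measurable_indic.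
by exists 1 => x; rewrite indicE; case: (_ \in _); rewrite ?normr1 ?normr0.
Qed.

Definition mean P f : R := (\int[P]_x f x)%R.

Lemma mean_lin P a f g : bounded_mfun f -> bounded_mfun g ->
  mean P (fun x => a * f x + g x) = a * mean P f + mean P g.
Proof.
move=> bf bg; rewrite /mean RintegralD //; last exact: bmf_integrable.
  by rewrite RintegralZl //; exact: bmf_integrable.
have := bmf_lin a bf (bmf_cst 0).
by under eq_fun do rewrite addr0; exact: bmf_integrable.
Qed.

Lemma mean_sum P (I : Type) (s : seq I) (w : I -> R) (f : I -> T -> R) :
  (forall i, bounded_mfun (f i)) ->
  mean P (fun x => \sum_(i <- s) w i * f i x) = \sum_(i <- s) w i * mean P (f i).
Proof.
move=> bf; elim: s => [|i s IH].
  rewrite big_nil; under [X in mean P X]eq_fun do rewrite big_nil.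
  by rewrite /mean Rintegral_cst // mul0r.
rewrite big_cons; under [X in mean P X]eq_fun do rewrite big_cons.
rewrite mean_lin // ?IH //; apply: bmf_sum => j.
by have := bmf_lin (w j) (bf j) (bmf_cst 0); under eq_fun do rewrite addr0.
Qed.

Lemma mean_indic P A : measurable A -> mean P (\1_A) = pr P A.
Proof. by move=> mA; rewrite /mean /Rintegral integral_indic // setIT. Qed.

Lemma mean_dist P f g c : bounded_mfun f -> bounded_mfun g -> (forall x, `|f x - g x| <= c) ->
  `|mean P f - mean P g| <= c.
Proof.
move=> bf bg fg.
have bfg : bounded_mfun (fun x => f x - g x).
  have := bmf_lin (-1) bg bf; congr bounded_mfun; apply: funext => x.
  by rewrite mulN1r addrC.
rewrite /mean -RintegralB //; try exact: bmf_integrable.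
apply: le_trans (le_normr_Rintegral _ (bmf_integrable P bfg)) _ => //.
have -> : c = (\int[P]_x c)%R.
  by rewrite Rintegral_cst // -/(pr P setT) prT mulr1.
apply: le_Rintegral => //; last exact: (bmf_integrable P (bmf_cst c)).
apply: (bmf_integrable P); split; first exact: measurableT_comp bfg.1.
by exists c => x; rewrite normr_id.
Qed.

End bounded_measurable.

Section stationarity_estimate.
Context {R : realType} {d : nat}.
Implicit Types (mu : probability (config d) R) (B : set (config d)).

Definition shift_inv B := forall c h, B h -> B (raise c h).

Lemma shift_inv_drop x B : shift_inv B -> shift_inv (drop_at x @^-1` B).
Proof. by move=> sB c h Bh; rewrite /preimage /= drop_raise; exact: sB. Qed.

Lemma shift_inv_recenter B h : shift_inv B -> B (recenter h) = B h.
Proof.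
move=> sB; apply/propext; split => [Bh|]; last exact: sB.
suff -> : h = raise (h 0 : int) (recenter h) by exact: sB.
by apply: config_eq => x; rewrite /raise /recenter subrK.
Qed.

(** The linear span of indicators of shift-invariant local events, given inductively so that
    identities known for events extend by induction to the functions produced by Euler steps. *)
Inductive cyl_fun (M : nat) : (config d -> R) -> Prop :=
| cyl_fun_indic B : local M B -> shift_inv B -> cyl_fun M (\1_B)
| cyl_fun_lin a G H : cyl_fun M G -> cyl_fun M H ->
    cyl_fun M (fun h => a * G h + H h).

Lemma cyl_fun_bmf M G : cyl_fun M G -> bounded_mfun G.
Proof.
elim=> [B lB _|a G' H _ IG _ IH]; last exact: bmf_lin.
by apply: bmf_indic; exact: local_measurable lB.
Qed.

Lemma indic_preimage (S T : Type) (f : S -> T) (B : set T) (h : S) :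
  \1_B (f h) = \1_(f @^-1` B) h :> R.
Proof.
by rewrite !indicE.
Qed.

Lemma cyl_fun_drop M G x : (snorm x <= M)%N -> cyl_fun M.+1 G ->
  cyl_fun M.+1 (G \o drop_at x).
Proof.
move=> xM; elim=> [B lB sB|a G' H _ IG _ IH]; last exact: cyl_fun_lin.
rewrite (_ : _ \o _ = \1_(drop_at x @^-1` B)); last first.
  by apply: funext => h /=; rewrite indic_preimage.
by apply: cyl_fun_indic; [exact: local_drop|exact: shift_inv_drop].
Qed.

Lemma cyl_fun_step e M D G : (D `<=` boxf M)%fset -> cyl_fun M.+1 G ->
  cyl_fun M.+1 (step e D G).
Proof.
move=> DM cG.
have H (s : seq (site d)) : {subset s <= boxf M} ->
    cyl_fun M.+1 (fun h => G h + e * \sum_(x <- s) (G (drop_at x h) - G h)).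
  elim: s => [|x s IH] sM.
    rewrite (_ : (fun _ => _) = G) //; apply: funext => h.
    by rewrite big_nil mulr0 addr0.
  have xM : (snorm x <= M)%N by rewrite -in_boxf sM // mem_head.
  have cs := IH (fun y ys => sM y (mem_behead (s := x :: s) ys)).
  have := cyl_fun_lin e (cyl_fun_drop xM cG) (cyl_fun_lin (- e) cG cs).
  congr cyl_fun; apply: funext => h /=; rewrite big_cons; ring.
by apply: H => x; move/fsubsetP: DM; exact.
Qed.

Lemma bmf_drop x (G : config d -> R) : bounded_mfun G -> bounded_mfun (G \o drop_at x).
Proof.
move=> [mG [N GN]]; split; last by exists N => h; exact: GN.
by apply: measurableT_comp => //; exact: measurable_drop.
Qed.

Lemma bmf_dropB x (G : config d -> R) : bounded_mfun G ->
  bounded_mfun (fun h => G (drop_at x h) - G h).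
Proof.
move=> bG; have := bmf_lin (-1) bG (bmf_drop x bG).
by congr bounded_mfun; apply: funext => h /=; rewrite mulN1r addrC.
Qed.

Lemma bmf_step e D (G : config d -> R) : bounded_mfun G -> bounded_mfun (step e D G).
Proof.
move=> bG; have := bmf_lin e (bmf_sum D (fun x => bmf_dropB x bG)) bG.
by congr bounded_mfun; apply: funext => h; rewrite addrC.
Qed.

(** The integral of the generator applied to the indicator of [B] vanishes: the sum over [boxf M] is
    the full sum over Z^d, since updates elsewhere do not affect [B]. *)
Definition gen_invariant mu := forall M B, local M B -> shift_inv B ->
  \sum_(x <- boxf M) (pr mu (drop_at x @^-1` B) - pr mu B) = 0.

Lemma mean_step_inv mu e M G : gen_invariant mu -> cyl_fun M G ->
  mean mu (step e (boxf M) G) = mean mu G.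
Proof.
move=> gi cG.
have bG := cyl_fun_bmf cG.
have key : \sum_(x <- boxf M) (mean mu (G \o drop_at x) - mean mu G) = 0.
  elim: cG => [B lB sB|a G1 G2 c1 I1 c2 I2].
    rewrite -[RHS](gi M B lB sB); apply: eq_bigr => x _.
    rewrite (_ : _ \o _ = \1_(drop_at x @^-1` B)); last first.
      by apply: funext => h /=; rewrite indic_preimage.
    rewrite !mean_indic //; first exact: local_measurable lB.
    by apply: measurable_preimageT (measurable_drop x) _; exact: local_measurable lB.
  have b1 := cyl_fun_bmf c1; have b2 := cyl_fun_bmf c2.
  under eq_bigr => x _.
    rewrite (_ : _ \o _ = fun h => a * (G1 \o drop_at x) h + (G2 \o drop_at x) h) //.
    rewrite !mean_lin //; try exact: bmf_drop.
    rewrite opprD addrACA -mulrBr.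
    over.
  by rewrite big_split /= -mulr_sumr I1 I2 mulr0 addr0.
have bS := bmf_sum (boxf M) (fun x => bmf_dropB x bG).
rewrite /step (_ : (fun h => _) = fun h =>
    e * \sum_(x <- boxf M) (G (drop_at x h) - G h) + G h); last first.
  by apply: funext => h; rewrite addrC.
rewrite mean_lin // (_ : mean mu _ = 0) ?mulr0 ?add0r //.
rewrite -[RHS]key.
rewrite (_ : (fun h => _) = fun h => \sum_(x <- boxf M) 1 * (G (drop_at x h) - G h)); last first.
  by apply: funext => h; apply: eq_bigr => x _; rewrite mul1r.
rewrite mean_sum; last by move=> x; exact: bmf_dropB.
apply: eq_bigr => x _; rewrite mul1r.
rewrite (_ : (fun h => _) = fun h => (-1) * G h + (G \o drop_at x) h); last first.
  by apply: funext => h /=; rewrite mulN1r addrC.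
by rewrite mean_lin //; [rewrite mulN1r addrC|exact: bmf_drop].
Qed.

(** The constant [q ^+ r] makes the profile at least 1 on [boxf r]; the heights outside have no
    influence. *)
Lemma osc_indic q r B : 1 <= q -> local r B ->
  osc_le (\1_B : config d -> R) (decay q (q ^+ r)).
Proof.
move=> q1 lB y h h' hh'; have q0 : 0 < q by exact: lt_le_trans q1.
have [yr|ry] := leqP (snorm y) r.
  apply: (@le_trans _ _ 1).
    rewrite !indicE; do 2 case: (_ \in _);
    by rewrite ?subrr ?subr0 ?sub0r ?normrN ?normr1 ?normr0.
  by rewrite /decay ler_pdivlMr ?exprn_gt0 // mul1r ler_weXn2l.
have e z : (snorm z <= r)%N -> h z = h' z.
  by move=> zr; apply: hh'; apply: contraTneq zr => ->; rewrite -ltnNge.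
have -> : \1_B h = \1_B h' :> R.
  rewrite !indicE (_ : (h \in B) = (h' \in B)) //.
  by apply/idP/idP; rewrite !inE; apply: lB => z /e.
by rewrite subrr normr0 decay_ge0 // exprn_ge0 // ltW.
Qed.

Lemma localn_indic r B : local r B -> localn r (\1_B : config d -> R).
Proof.
move=> lB h h' hh'; rewrite !indicE (_ : (h \in B) = (h' \in B)) //.
by apply/idP/idP; rewrite !inE; apply: lB => z /hh'.
Qed.

(* The number of sites of [boxf M.+1] times the oscillation at distance [M.+1],
   up to time [t], of the indicator of an event depending on [boxf r]. *)
Definition leak (q : R) (r : nat) (t : R) (M : nat) : R :=
  ((2 * M.+1).+1 ^ d)%:R * (q ^+ r * expR (t * (2 * d)%:R * q) * q ^- M.+1).

(* One step of the dynamics in a larger box [D] differs from one step in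
   [boxf M] only through the sites at distance [M.+1], whose influence on the
   event [B] decays geometrically. *)
Lemma step_leak e q r M D B k m h : 0 <= e -> e * #|` boxf M : {fset site d}|%:R <= 1 ->
  1 <= q -> (r <= M)%N -> local r B -> (boxf M `<=` D)%fset -> (k <= m)%N ->
  `|step e D (iter k (step e (boxf M)) (\1_B)) h
    - iter k.+1 (step e (boxf M)) (\1_B) h| <= e * leak q r (m%:R * e) M.
Proof.
move=> e0 eM q1 rM lB MD km; rewrite iterS; set G := iter k _ _.
have q0 : 0 < q by exact: lt_le_trans q1.
have x0 : 0 <= e * (2 * d)%:R * q by rewrite !mulr_ge0 // ltW.
have oG := osc_iter_step q1 k e0 eM (exprn_ge0 r (ltW q0)) (osc_indic q1 lB).
have lG : localn M.+1 G.
  by apply: localn_iter_step => //; apply: localn_le (localn_indic lB); exact: leqW.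
have c0 : 0 <= q ^+ r * (1 + e * (2 * d)%:R * q) ^+ k.
  by rewrite mulr_ge0 ?exprn_ge0 ?addr_ge0 // ltW.
apply: le_trans (step_subset q1 h e0 c0 MD lG oG) _.
rewrite ler_wpM2l // ler_wpM2l // ler_wpM2r ?invr_ge0 ?exprn_ge0 ?(ltW q0) //.
rewrite ler_pM2l ?exprn_gt0 //.
(* The growth of the oscillation is bounded uniformly in [k <= m], then compounded growth is
   compared with the exponential. *)
apply: (@le_trans _ _ ((1 + e * (2 * d)%:R * q) ^+ m)).
  by rewrite ler_weXn2l // lerDl.
rewrite (_ : m%:R * e * (2 * d)%:R * q = m%:R * (e * (2 * d)%:R * q)); last by ring.
by rewrite expRM_natl lerXn2r ?nnegrE ?addr_ge0 ?expR_ge0 // expR_ge1Dx.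
Qed.

(** The [k]-th iterate has radius [M.+1], so its mean is preserved exactly by the step in
    [boxf M.+1]. Using the step in [boxf M] instead costs one boundary term per step. *)
Lemma mean_iter_step mu e q r M B m : gen_invariant mu ->
  0 <= e -> e * #|` boxf M.+1 : {fset site d}|%:R <= 1 ->
  1 <= q -> (r <= M)%N -> local r B -> shift_inv B ->
  `|mean mu (iter m (step e (boxf M)) (\1_B)) - pr mu B|
    <= m%:R * (e * leak q r (m%:R * e) M).
Proof.
move=> gi e0 eM1 q1 rM lB sB.
have eM : e * #|` boxf M : {fset site d}|%:R <= 1.
  apply: le_trans eM1; rewrite ler_wpM2l // ler_nat.
  exact/fsubset_leq_card/boxf_sub.
have cG k : cyl_fun M.+1 (iter k (step e (boxf M)) (\1_B)).
  elim: k => [|k IH]; last exact: cyl_fun_step.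
  by apply: cyl_fun_indic => //; apply: local_le lB; exact: leqW.
suff H k : (k <= m)%N ->
  `|mean mu (iter k (step e (boxf M)) (\1_B)) - pr mu B|
    <= k%:R * (e * leak q r (m%:R * e) M) by exact: H.
elim: k => [_|k IH km].
  by rewrite /= mean_indic ?subrr ?normr0 ?mul0r //; exact: local_measurable lB.
apply: le_trans (ler_distD (mean mu (iter k (step e (boxf M)) (\1_B))) _ _) _.
rewrite -natr1 mulrDl mul1r addrC lerD //; first exact/IH/ltnW.
(* The mean of the [k]-th iterate is rewritten as that of its image under the step in the larger
   box. *)
rewrite -(mean_step_inv e gi (cG k)) distrC.
apply: mean_dist => [||h].
- exact/bmf_step/cyl_fun_bmf/cG.
- exact/cyl_fun_bmf/(cG k.+1).
apply: step_leak => //; first exact/boxf_sub/leqnSn.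
exact: ltnW.
Qed.

End stationarity_estimate.

(** * Uniform updates stopped at a geometric time *)

(** Connectedness of Z^d: moving a nonzero coordinate by one unit towards 0 gives a neighbour of
    smaller l1 norm. *)
Lemma site_ind d (Q : site d -> Prop) : Q 0 ->
  (forall x y, y \in nbrs x -> Q x -> Q y) -> forall x, Q x.
Proof.
move=> Q0 Qn x; pose l1 (y : site d) := (\sum_(i < d) absz (y ord0 i))%N.
have [n] := ubnP (l1 x); elim: n => // n IH in x *; rewrite ltnS => xn.
have [->//|x0] := eqVneq x 0.
have [i xi] : exists i, x ord0 i != 0.
  apply/existsP; apply: contraR x0; rewrite negb_exists => /forallP H.
  by apply/eqP/rowP => i; rewrite mxE; apply/eqP; rewrite -[_ == _]negbK H.
have step y : y \in nbrs x -> (forall j, j != i -> y ord0 j = x ord0 j) ->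
    (absz (y ord0 i) < absz (x ord0 i))%N -> Q x.
  move=> xy ye yi; apply: (Qn y); first by rewrite nbrs_sym.
  apply: IH; apply: leq_trans xn; rewrite /l1 (bigD1 i) //= [X in (_ < X)%N](bigD1 i) //=.
  rewrite (eq_bigr (fun j => absz (x ord0 j))) ?ltn_add2r // => j ji.
  by rewrite ye.
have bi j : (basis_vec i : site d) ord0 j = (j == i)%:R by rewrite mxE eqxx.
have aE (u v : site d) j : (u + v) ord0 j = u ord0 j + v ord0 j by rewrite mxE.
have nE (u : site d) j : (- u) ord0 j = - u ord0 j by rewrite mxE.
have [x_pos|x_neg] := ltP 0 (x ord0 i).
  apply: (step (x - basis_vec i)).
  - by apply/nbrsP; exists i; right.
  - by move=> j ji; rewrite aE nE bi (negbTE ji) subr0.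
  rewrite aE nE bi eqxx; move: x_pos; move: (x _ _) => z; clear; lia.
apply: (step (x + basis_vec i)).
- by apply/nbrsP; exists i; left.
- by move=> j ji; rewrite aE bi (negbTE ji) addr0.
rewrite aE bi eqxx; move: x_neg xi; move: (x _ _) => z; clear; lia.
Qed.

Section abel.
Context {R : realType}.

(** The induction closes once the final term [q ^+ L * b L] is kept in the bound: a further factor
    [q <= 1] only lowers it. *)
Lemma abel_lower_bound (q : R) (b : nat -> R) L : 0 <= q <= 1 ->
  (forall m, 0 <= b m) ->
  - b 0%N <= \sum_(m < L) q ^+ m * (b m.+1 - b m).
Proof.
move=> /andP[q0 q1] b0.
suff : q ^+ L * b L - b 0%N <= \sum_(m < L) q ^+ m * (b m.+1 - b m).
  by apply: le_trans; rewrite lerDr mulr_ge0 ?exprn_ge0.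
elim: L => [|L IH]; first by rewrite big_ord0 mul1r subrr.
rewrite big_ord_recr /=; apply: le_trans (lerD IH (lexx _)).
rewrite exprSr; have : 0 <= q ^+ L * ((1 - q) * b L.+1).
  by rewrite !mulr_ge0 ?exprn_ge0 ?subr_ge0.
by lra.
Qed.

Lemma geometric_le (p : R) L : 0 < p < 1 -> p * \sum_(m < L) (1 - p) ^+ m <= 1.
Proof.
move=> /andP[p0 p1]; have -> : p * \sum_(m < L) (1 - p) ^+ m = 1 - (1 - p) ^+ L.
  elim: L => [|L IH]; first by rewrite big_ord0 mulr0 subrr.
  by rewrite big_ord_recr /= mulrDr IH exprS; ring.
by rewrite gerBl exprn_ge0 // subr_ge0 ltW.
Qed.

End abel.

Section box_dynamics.
Context {R : realType} {d : nat}.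
Implicit Types (G H : config d -> R) (h : config d) (x y : site d).

Lemma step_site e D (F : int -> R) x h :
  step e D (fun h => F (h x)) h =
  F (h x) + e * (if x \in D then F (deposit h x) - F (h x) else 0).
Proof.
rewrite /step; congr (_ + e * _); case: ifPn => xD.
  rewrite (bigD1_seq x) ?fset_uniq //= drop_same big1 ?addr0 // => y yx.
  by rewrite drop_other ?subrr // eq_sym.
rewrite big1_seq // => y /= yD; rewrite drop_other ?subrr //.
by apply: contraNneq xD => ->.
Qed.

Variables (D : {fset site d}) (D0 : (0 < #|` D|)%N).

Let e : R := (#|` D|%:R)^-1.

Let e0 : 0 < e. Proof. by rewrite invr_gt0 ltr0n. Qed.

Let eD : e * #|` D|%:R = 1.
Proof. by rewrite mulVf // pnatr_eq0 -lt0n. Qed.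

(** For this value of [e] the identity part of [step] has weight 0: the Euler step is exactly one
    update at a uniform site of [D]. *)
Lemma step_avg G h : step e D G h = e * \sum_(x <- D) G (drop_at x h).
Proof. by rewrite stepE eD subrr mul0r add0r. Qed.

(* Expectation of [G] at the state reached from the flat configuration after
   [m] updates at independent uniform sites of [D]. *)
Definition expect m G : R := iter m (step e D) G (fun=> 0).

(** The additional step acts on [G] first, hence stands for the last update in time. *)
Lemma expectS m G : expect m.+1 G = expect m (step e D G).
Proof. by rewrite /expect iterSr. Qed.

Lemma expect_le m G H : (forall h, G h <= H h) -> expect m G <= expect m H.
Proof.
move=> GH; suff : forall h, iter m (step e D) G h <= iter m (step e D) H h by exact.
elim: m => // m IH h; rewrite !iterS !step_avg ler_wpM2l ?(ltW e0) //.
by apply: ler_sum => x _; exact: IH.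
Qed.

Lemma eq_expect m G H : (forall h, G h = H h) -> expect m G = expect m H.
Proof. by move=> GH; congr (expect m _); apply: funext. Qed.

Lemma expect_lin m a G H :
  expect m (fun h => a * G h + H h) = a * expect m G + expect m H.
Proof.
rewrite /expect; move: (fun=> 0) => h; elim: m => // m IH in h *.
rewrite !iterS !step_avg mulrCA -mulrDr; congr (_ * _).
rewrite mulr_sumr -big_split /=.
by apply: eq_bigr => x _; exact: IH.
Qed.

Lemma expect_cst m a : expect m (fun=> a) = a.
Proof.
rewrite /expect; move: (fun=> 0) => h; elim: m => // m IH in h *.
rewrite iterS step_avg (eq_bigr (fun=> a)) => [|x _]; last exact: IH.
by rewrite big_const_seq count_predT iter_addr_0 -mulr_natl mulrA eD mul1r.
Qed.

Lemma expectD m G H : expect m (fun h => G h + H h) = expect m G + expect m H.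
Proof. by rewrite -[expect m G]mul1r -expect_lin; apply: eq_expect => h; rewrite mul1r. Qed.

Lemma expectZ m a G : expect m (fun h => a * G h) = a * expect m G.
Proof.
rewrite -[RHS]addr0 -(expect_cst m 0) -expect_lin.
by apply: eq_expect => h; rewrite addr0.
Qed.

Lemma expect_sum m (s : seq (site d)) (G : site d -> config d -> R) :
  expect m (fun h => \sum_(x <- s) G x h) = \sum_(x <- s) expect m (G x).
Proof.
elim: s => [|x s IH].
  by rewrite big_nil -[RHS](expect_cst m 0); apply: eq_expect => h; rewrite big_nil.
rewrite big_cons -IH -expectD; apply: eq_expect => h; exact: big_cons.
Qed.

Lemma expect_increment m G : expect m.+1 G - expect m G =
  e * \sum_(x <- D) (expect m (G \o drop_at x) - expect m G).
Proof.
rewrite expectS /step expectD addrAC subrr add0r expectZ expect_sum.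
congr (_ * _); apply: eq_bigr => x _.
rewrite (eq_expect _ (H := fun h => (-1) * G h + (G \o drop_at x) h)) ?expect_lin.
  by rewrite mulN1r addrC.
by move=> h /=; rewrite mulN1r addrC.
Qed.

(** The exponential of a deposited height is at most [expR 1] times the sum of the exponentials over
    the site and its [2 * d] neighbours, which replaces the maximum by a linear recursion. *)
Let kappa : R := expR 1 * (2 * d).+1%:R.

Let kappa0 : 0 <= kappa. Proof. by rewrite mulr_ge0 ?expR_ge0. Qed.

Lemma expect_exp m x :
  expect m (fun h => expR (h x : int)%:~R) <= (1 + e * kappa) ^+ m.
Proof.
elim: m => [|m IH] in x *; first by rewrite /expect /= expR0.
rewrite expectS.
pose F y h : R := expR (h y : int)%:~R.
apply: (@le_trans _ _ (expect m (fun h => F x h + e * expR 1 * \sum_(y <- x :: nbrs x) F y h))).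
  apply: expect_le => h; rewrite (step_site e D (fun v : int => expR v%:~R)) lerD //.
  rewrite -mulrA ler_wpM2l ?(ltW e0) // mulr_sumr.
  have F0 y : 0 <= expR 1 * F y h by rewrite mulr_ge0 ?expR_ge0.
  have F1 y : F y h <= expR 1 * F y h.
    by rewrite ler_peMl ?expR_ge0 // -[leLHS]expR0 ler_expR.
  case: ifP => _; last by rewrite sumr_ge0.
  rewrite lerBlDr; apply: ler_wpDr; first exact: expR_ge0.
  case: (deposit_attained h x) => [->|[y xy ->]].
    by rewrite intrD expRD mulrC big_cons lerDl sumr_ge0.
  rewrite (big_rem y) ?in_cons ?xy ?orbT //=.
  by apply: le_trans (F1 y) _; rewrite lerDl sumr_ge0.
rewrite expectD expectZ expect_sum exprSr mulrDr mulr1 lerD ?IH //.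
have S : \sum_(y <- x :: nbrs x) expect m (F y) <= (2 * d).+1%:R * (1 + e * kappa) ^+ m.
  apply: le_trans (ler_sum _ (fun y _ => IH y)) _.
  by rewrite big_const_seq count_predT iter_addr_0 /= size_nbrs mulr_natl.
apply: le_trans (ler_wpM2l _ S) _; first by rewrite mulr_ge0 ?expR_ge0 ?(ltW e0).
by rewrite [leLHS](_ : _ = (1 + e * kappa) ^+ m * (e * kappa)) // /kappa; ring.
Qed.

(** The inequality [v <= expR (v - l) + l] plays the role of Jensen's inequality; [l] is chosen so
    that the exponential moment is at most [expR l]. *)
Lemma expect_height m x :
  expect m (fun h => (h x : int)%:~R) <= m%:R * (e * kappa) + 1.
Proof.
set l := m%:R * (e * kappa).
apply: (@le_trans _ _ (expect m (fun h => expR (- l) * expR (h x : int)%:~R + l))).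
  apply: expect_le => h; rewrite -expRD -lerBlDr addrC.
  by apply: le_trans (expR_ge1Dx _); rewrite lerDr.
rewrite expect_lin expect_cst addrC lerD2l.
apply: le_trans (ler_wpM2l (expR_ge0 _) (expect_exp m x)) _.
rewrite expRN mulrC ler_pdivrMr ?expR_gt0 // mul1r /l expRM_natl.
by rewrite lerXn2r ?nnegrE ?addr_ge0 ?mulr_ge0 ?expR_ge0 ?expR_ge1Dx // ltW.
Qed.

Variables (p : R) (p01 : 0 < p < 1).

(** The contribution of the times below [L] to the expectation of [G] at the geometric time. *)
Definition geo L G : R := \sum_(m < L) p * (1 - p) ^+ m * expect m G.

Let p0 : 0 < p. Proof. by case/andP: p01. Qed.

Let q01 : 0 <= 1 - p <= 1.
Proof. by case/andP: p01 => ? ?; rewrite subr_ge0 gerBl !ltW. Qed.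

Let w0 m : 0 <= p * (1 - p) ^+ m.
Proof. by rewrite mulr_ge0 ?exprn_ge0 ?(ltW p0) //; case/andP: q01. Qed.

Lemma geo_le L G H : (forall h, G h <= H h) -> geo L G <= geo L H.
Proof. by move=> GH; apply: ler_sum => m _; rewrite ler_wpM2l // expect_le. Qed.

Lemma geoD L G H : geo L (fun h => G h + H h) = geo L G + geo L H.
Proof. by rewrite -big_split; apply: eq_bigr => m _ /=; rewrite expectD mulrDr. Qed.

Lemma geoZ L a G : geo L (fun h => a * G h) = a * geo L G.
Proof. by rewrite mulr_sumr; apply: eq_bigr => m _; rewrite expectZ mulrCA. Qed.

Lemma geo_increments L G :
  p * #|` D|%:R * \sum_(m < L) (1 - p) ^+ m * (expect m.+1 G - expect m G) =
  \sum_(x <- D) (geo L (G \o drop_at x) - geo L G).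
Proof.
rewrite mulr_sumr.
under [RHS]eq_bigr do rewrite -sumrB.
rewrite exchange_big /=; apply: eq_bigr => m _.
rewrite expect_increment.
under [RHS]eq_bigr do rewrite -mulrBr.
rewrite -mulr_sumr; set S := \sum_(x <- D) _.
rewrite [in RHS](_ : S = e * #|` D|%:R * S); last by rewrite eD mul1r.
ring.
Qed.

Lemma geo_gap L x : x \in D ->
  geo L (fun h => (deposit h x - (h x : int))%:~R) <= kappa + p * #|` D|%:R.
Proof.
move=> xD.
pose a m := expect m (fun h => (h x : int)%:~R).
(* The slack in the linear height bound is nonnegative and starts at 1, so its discounted increments
   sum to at least -1. The discounted growth of the mean height thus exceeds that of the linear
   bound by at most 1. *)
pose b m := m%:R * (e * kappa) + 1 - a m.
have b0 m : 0 <= b m by rewrite subr_ge0 expect_height.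
have bnd := abel_lower_bound L q01 b0.
have b00 : b 0%N = 1 by rewrite /b /a /expect /= mul0r add0r subr0.
have -> : geo L (fun h => (deposit h x - (h x : int))%:~R) =
    p * #|` D|%:R * \sum_(m < L) (1 - p) ^+ m * (a m.+1 - a m).
  rewrite /geo mulr_sumr; apply: eq_bigr => m _.
  rewrite /a expectS.
  rewrite (eq_expect _ (G := step _ _ _) (H := fun h =>
     e * (deposit h x - (h x : int))%:~R + (h x : int)%:~R)); last first.
    move=> h; rewrite (step_site e D (fun v : int => v%:~R)) xD addrC.
    by rewrite intrB.
  rewrite expect_lin addrK; set E := expect m _.
  rewrite [in LHS](_ : E = e * #|` D|%:R * E); last by rewrite eD mul1r.
  ring.
have -> : \sum_(m < L) (1 - p) ^+ m * (a m.+1 - a m) =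
    (e * kappa) * \sum_(m < L) (1 - p) ^+ m - \sum_(m < L) (1 - p) ^+ m * (b m.+1 - b m).
  rewrite mulr_sumr -sumrB; apply: eq_bigr => m _.
  by rewrite /b -[m.+1%:R]natr1; ring.
rewrite mulrBr lerD //.
  set S := \sum_(m < L) _.
  rewrite [leLHS](_ : _ = p * S * kappa * (e * #|` D|%:R)); last by ring.
  by rewrite eD mulr1 ler_piMl // geometric_le.
rewrite lerNl -[leLHS]mulrN1 ler_wpM2l ?mulr_ge0 ?(ltW p0) //.
by move: bnd; rewrite b00.
Qed.

(** Summation by parts is applied to the means of [G] and of [1 - G], one for each side of the
    absolute value. *)
Lemma geo_generator L G : (forall h, 0 <= G h <= 1) ->
  `|\sum_(x <- D) (geo L (G \o drop_at x) - geo L G)| <= p * #|` D|%:R.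
Proof.
move=> G01; rewrite -geo_increments normrM ger0_norm ?mulr_ge0 ?(ltW p0) //.
rewrite ler_piMr ?mulr_ge0 ?(ltW p0) // ler_norml.
have a0 m : 0 <= expect m G.
  by rewrite -(expect_cst m 0) expect_le // => h; case/andP: (G01 h).
have a1 m : 0 <= 1 - expect m G.
  by rewrite subr_ge0 -[leRHS](expect_cst m 1) expect_le // => h; case/andP: (G01 h).
apply/andP; split.
  by apply: le_trans (abel_lower_bound L q01 a0); rewrite lerN2 -subr_ge0.
have := abel_lower_bound L q01 a1.
rewrite [X in _ <= X](_ : _ = - \sum_(m < L) (1 - p) ^+ m * (expect m.+1 G - expect m G)).
  by rewrite lerN2 => /le_trans; apply; rewrite gerBl.
by rewrite -sumrN; apply: eq_bigr => m _; ring.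
Qed.

(** A deposition at the lower of two neighbouring sites lifts it at least to the height of the other
    one, so the height difference is bounded by the sum of the two gaps. *)
Lemma geo_nbr L x y : x \in D -> y \in D -> y \in nbrs x ->
  geo L (fun h => `|(h x : int) - (h y : int)|%:~R) <= 2 * (kappa + p * #|` D|%:R).
Proof.
move=> xD yD xy; rewrite mulrDl mul1r.
apply: le_trans (lerD (geo_gap L xD) (geo_gap L yD)).
rewrite -geoD; apply: geo_le => h; rewrite -intrD ler_int.
have h1 := deposit_self h x; have h2 := deposit_self h y.
have h3 : (h y : int) <= deposit h x by exact: deposit_nbr.
have h4 : (h x : int) <= deposit h y by apply: deposit_nbr; rewrite nbrs_sym.
move: h1 h2 h3 h4; move: (h x : int) (h y : int) (deposit h x) (deposit h y); lia.
Qed.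

End box_dynamics.

(** * The law of the walk with uniform updates *)

Section finite_probability.
Context {R : realType} {disp : measure_display} {T : measurableType disp}.
Variable P : probability T R.
Implicit Types (A B E : set T).

Lemma prU A B : measurable A -> measurable B -> A `&` B = set0 ->
  pr P (A `|` B) = pr P A + pr P B.
Proof.
by move=> mA mB AB; rewrite /pr measureU // fineD // fin_num_measure.
Qed.

Lemma prI_C A B : measurable A -> measurable B ->
  pr P A = pr P (A `&` B) + pr P (A `&` ~` B).
Proof.
move=> mA mB; rewrite -prU.
- by rewrite -setIUr setUCr setIT.
- exact: measurableI.
- by apply: measurableI => //; exact: measurableC.
- by rewrite setIACA setICr setI0.
Qed.

Lemma prU_le A B : measurable A -> measurable B -> pr P (A `|` B) <= pr P A + pr P B.
Proof.
move=> mA mB; have mBA := measurableD mB mA.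
have -> : A `|` B = A `|` (B `\` A).
  by rewrite setUDr setDv setD0.
rewrite (prU mA mBA); last by apply/seteqP; split => // w [Aw []].
by rewrite lerD2l pr_le // => w [].
Qed.

Lemma pr_bigcup_seq (I : eqType) (s : seq I) (F : I -> set T) : uniq s ->
  (forall i, measurable (F i)) ->
  {in s &, forall i j, i != j -> F i `&` F j = set0} ->
  pr P (\bigcup_(i in [set` s]) F i) = \sum_(i <- s) pr P (F i).
Proof.
move=> + mF; elim: s => [_ _|x s IH /= /andP[xs us] tF].
  by rewrite big_nil bigcup0 /pr ?measure0 // => i.
have tF' : {in s &, forall i j, i != j -> F i `&` F j = set0}.
  by move=> i j si sj; apply: tF; rewrite in_cons ?si ?sj orbT.
rewrite big_cons -IH // -prU //.
- congr (pr P _); apply/seteqP; split => [w [i /=]|w].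
    by rewrite inE => /predU1P[->|si Fi]; [left|right; exists i].
  by case=> [Fw|[i /= si Fi]]; [exists x|exists i] => //=; rewrite inE ?eqxx ?si ?orbT.
- by apply: fin_bigcup_measurable.
- apply/seteqP; split => // w [Fx [i /= si Fi]].
  have : (F x `&` F i) w by [].
  rewrite tF ?mem_head ?in_cons ?si ?orbT //.
  by apply: contraNneq xs => ->.
Qed.

Lemma pr_setI_full A B : measurable A -> measurable B -> pr P B = 1 ->
  pr P A = pr P (A `&` B).
Proof.
move=> mA mB B1; rewrite (prI_C mA mB) -[RHS]addr0; congr (_ + _).
have mC := measurableC mB.
apply/eqP; rewrite eq_le pr_ge0 andbT.
apply: (@le_trans _ _ (pr P (~` B))); last by rewrite prC // B1 subrr.
by apply: pr_le => //; exact: measurableI.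
Qed.

Lemma pr_split (I : eqType) (s : seq I) (F : I -> set T) E : uniq s ->
  (forall i, measurable (F i)) ->
  {in s &, forall i j, i != j -> F i `&` F j = set0} ->
  \sum_(i <- s) pr P (F i) = 1 -> measurable E ->
  pr P E = \sum_(i <- s) pr P (E `&` F i).
Proof.
move=> us mF tF F1 mE.
rewrite -pr_bigcup_seq //; last first.
- by move=> i j si sj ij; rewrite setIACA tF // setI0.
- by move=> i; exact: measurableI.
rewrite -setI_bigcupr -pr_setI_full // ?pr_bigcup_seq //.
by apply: fin_bigcup_measurable.
Qed.

Lemma mutually_independent_seq (I : choiceType) (F : I -> set_system T)
    (s : seq I) (A : I -> set T) :
  mutually_independent P F -> uniq s -> (forall i, i \in s -> F i (A i)) ->
  (forall i, i \in s -> measurable (A i)) ->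
  pr P (\bigcap_(i in [set` s]) A i) = \prod_(i <- s) pr P (A i).
Proof.
move=> indF us FA mA; pose J := [fset i in s]%fset.
have Js : perm_eq J s.
  by apply: uniq_perm => // i; rewrite !inE.
have := indF J A; rewrite (perm_big _ Js) /=.
have -> : [set` J] = [set` s] by apply/seteqP; split => i /=; rewrite !inE.
move=> H; rewrite /pr H; last by move=> i; rewrite !inE; exact: FA.
rewrite big_seq (eq_bigr (fun i => (pr P (A i))%:E)).
  by rewrite -big_seq prodEFin.
by move=> i si; apply: prE; exact: mA.
Qed.

End finite_probability.

Lemma eq_discrete_bd d (s s' : nat -> site d) m :
  (forall i, (i < m)%N -> s i = s' i) -> discrete_bd s m = discrete_bd s' m.
Proof.
elim: m => //= m IH ss'; rewrite ss' ?IH // => i im.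
by apply: ss'; exact: ltnW.
Qed.

Section uniform_updates.
Context {R : realType} {d : nat} {disp : measure_display} {T : measurableType disp}.
Variables (P : probability T R) (N : nat) (X : nat -> T -> site d).
Hypothesis mX : forall k, measurable_fun setT (X k).
Hypothesis X_unif : forall k, uniform_on P (X k) (box d N).
Hypothesis X_indep :
  mutually_independent P (fun k => g_sigma_algebra_preimage (X k)).

Let B : {fset site d} := boxf N.
Let e : R := (#|` B|%:R)^-1.
Let f m w := discrete_bd (fun k => X k w) m.

Lemma measurable_fiber k x : measurable [set w | X k w = x].
Proof. by apply: (measurable_preimageT (A := [set x])) (mX k) _. Qed.

Definition starts_with (s : seq (site d)) : set T :=
  \bigcap_(i in [set` iota 0 (size s)]) [set w | X i w = nth 0 s i].

Lemma measurable_starts_with s : measurable (starts_with s).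
Proof. by apply: bigcap_countType_measurable => i _; exact: measurable_fiber. Qed.

Lemma starts_withE s w : starts_with s w = (mkseq (fun k => X k w) (size s) = s).
Proof.
apply/propext; split => [Hs|Hs i /=].
  apply: (@eq_from_nth _ 0); rewrite size_mkseq // => i si.
  by rewrite nth_mkseq //; apply: Hs; rewrite /= mem_iota.
by rewrite mem_iota => /= si; rewrite -Hs nth_mkseq.
Qed.

(** Histories are finite lists over a countable type, so for arbitrary [Q] the event is a countable
    union over admissible lists. *)
Lemma measurable_history (Q : seq (site d) -> Prop) (n : T -> nat) :
  (forall m, measurable [set w | n w = m]) ->
  measurable [set w | Q (mkseq (fun k => X k w) (n w))].
Proof.
move=> mn; rewrite (_ : [set w | _] =
  \bigcup_(s in [set s | Q s]) (starts_with s `&` [set w | n w = size s])).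
  apply: bigcup_countType_measurable => s _; apply: measurableI => //.
  exact: measurable_starts_with.
apply/seteqP; split => [w Qw|w [s Qs [+ nw]]].
  exists (mkseq (fun k => X k w) (n w)) => //=.
  by split; rewrite ?starts_withE size_mkseq.
by rewrite starts_withE /= nw => ->.
Qed.

Lemma measurable_stopped (n : T -> nat) : (forall m, measurable [set w | n w = m]) ->
  measurable_fun setT (fun w => f (n w) w).
Proof.
move=> mn _ A mA; rewrite setTI.
rewrite (_ : _ @^-1` _ = [set w | A (discrete_bd (nth 0 (mkseq (fun k => X k w) (n w)))
    (size (mkseq (fun k => X k w) (n w))))]).
  exact: (measurable_history (fun s => A (discrete_bd (nth 0 s) (size s)))).
apply/seteqP; split => w /=; rewrite size_mkseq /f;
  by rewrite (eq_discrete_bd (s := nth 0 _) (s' := fun k => X k w)) // => i ni;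
    rewrite nth_mkseq.
Qed.

Lemma measurable_walk m : measurable_fun setT (f m).
Proof.
apply: (measurable_stopped (n := fun=> m)) => k.
by have [->|mk] := eqVneq m k; [rewrite (_ : [set _ | _] = setT)|
  rewrite (_ : [set _ | _] = set0)] => //; apply/seteqP; split => // w /= /eqP;
  rewrite (negbTE mk).
Qed.

Lemma pr_fiber k x : x \in B -> pr P [set w | X k w = x] = e.
Proof.
move=> xB; rewrite /pr (X_unif k x) mem_box xB.
by rewrite fset_set_box.
Qed.

Lemma pr_starts_with s : {subset s <= B} -> pr P (starts_with s) = e ^+ size s.
Proof.
move=> sB; rewrite (mutually_independent_seq X_indep) ?iota_uniq //.
- rewrite big_seq (eq_bigr (fun=> e)).
    by rewrite -big_seq big_const_seq count_predT size_iota -Monoid.iteropE.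
  move=> i; rewrite mem_iota /= => si; apply: pr_fiber.
  by apply: sB; exact: mem_nth.
- by move=> i _; exists [set nth 0 s i] => //; rewrite setTI.
- by move=> i _; exact: measurable_fiber.
Qed.

(** The prefix [s] of past updates is carried along for the induction on the number [m] of remaining
    ones: the event is split by the next site, which extends the prefix. *)
Lemma pr_walk_from m s (A : set (config d)) : {subset s <= B} -> measurable A ->
  pr P (starts_with s `&` (f (size s + m) @^-1` A)) =
  e ^+ size s * iter m (step e B) (\1_A) (discrete_bd (nth 0 s) (size s)).
Proof.
move=> + mA; elim: m s => [|m IH] s sB.
  rewrite addn0 /=.
  have fs w : starts_with s w -> f (size s) w = discrete_bd (nth 0 s) (size s).
    rewrite starts_withE => ws; apply: eq_discrete_bd => i si.
    by rewrite -[in RHS]ws nth_mkseq.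
  rewrite indicE; case: (boolP (_ \in A)) => [|nA].
    rewrite inE => sA; rewrite mulr1 -pr_starts_with //; congr (pr P _).
    by apply/seteqP; split => [w []//|w ws]; split => //; rewrite /preimage /= fs.
  rewrite mulr0 (_ : _ `&` _ = set0) ?/pr ?measure0 //.
  apply/seteqP; split => // w [ws]; rewrite /preimage /= fs // => sA.
  by move: nA; rewrite notin_setE; exact.
have m1 : measurable (f (size s + m.+1) @^-1` A).
  exact: measurable_preimageT (measurable_walk _) mA.
rewrite (pr_split (s := B) (F := fun x => [set w | X (size s) w = x])).
- rewrite iterS step_avg ?card_boxf_gt0 // mulrA -exprSr mulr_sumr.
  rewrite big_seq [RHS]big_seq; apply: eq_bigr => x xB.
  have sxB : {subset rcons s x <= B}.
    by move=> y; rewrite mem_rcons inE => /predU1P[->//|/sB].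
  have st : discrete_bd (nth 0 (rcons s x)) (size s).+1 =
      drop_at x (discrete_bd (nth 0 s) (size s)).
    rewrite [LHS]/= nth_rcons ltnn eqxx /drop_at; congr (update [set x] _).
    by apply: eq_discrete_bd => i si; rewrite nth_rcons si.
  have := IH (rcons s x) sxB; rewrite size_rcons addSnnS => IHx.
  rewrite (_ : _ `&` _ = starts_with (rcons s x) `&` f (size s + m.+1) @^-1` A).
    by rewrite IHx st.
  rewrite setIAC; congr (_ `&` _); apply/seteqP; split => w.
    move=> [/= ws wx]; rewrite starts_withE size_rcons mkseqS.
    by move: ws; rewrite starts_withE => ->; rewrite wx.
  rewrite starts_withE size_rcons mkseqS => /rcons_inj[ws wx].
  by split => //; rewrite starts_withE.
- exact: fset_uniq.
- by move=> x; exact: measurable_fiber.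
- move=> x y _ _ xy; apply/seteqP; split => // w [/= -> /eqP].
  by rewrite (negbTE xy).
- rewrite big_seq (eq_bigr (fun=> e)) => [|x]; last exact: pr_fiber.
  rewrite -big_seq big_const_seq count_predT iter_addr_0 -mulr_natl.
  by rewrite divff // pnatr_eq0 -lt0n card_boxf_gt0.
- by apply: measurableI => //; exact: measurable_starts_with.
Qed.

Lemma pr_walk m (A : set (config d)) : measurable A ->
  pr P (f m @^-1` A) = expect B m (\1_A).
Proof.
move=> mA; have := @pr_walk_from m [::] A (fun x => ltac:(by [])) mA.
rewrite mul1r /expect => <-; congr (pr P _).
by apply/seteqP; split => [w fw|w []//]; split => // i.
Qed.

Variables (n : T -> nat) (p : R).
Hypothesis mn : forall m, measurable [set w | n w = m].
Hypothesis n_geom : geometric_law P n p.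
Hypothesis n_indep : independent2 P (g_sigma_algebra_preimage n)
  (generated_sigma f).

(** The event is split by the value of [n]; independence of [n] and the walk identifies the partial
    sums of the probabilities with [geo]. *)
Lemma pr_stopped (A : set (config d)) : measurable A ->
  geo B p ^~ (\1_A) @ \oo --> pr P [set w | A (f (n w) w)].
Proof.
move=> mA; pose F m := [set w | n w = m] `&` f m @^-1` A.
have mF m : measurable (F m).
  by apply: measurableI => //; exact: measurable_preimageT (measurable_walk m) mA.
have UF : \bigcup_m F m = [set w | A (f (n w) w)].
  apply/seteqP; split => [w [m _ Fm]|w Aw]; last by exists (n w).
  by case: Fm => <-.
have mU : measurable (\bigcup_m F m) by exact: bigcupT_measurable.
have tF : trivIset setT F.
  apply/trivIsetP => i j _ _ ij; apply/seteqP; split => // w [[ni _] [nj _]].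
  by move: ij; rewrite -ni -nj eqxx.
have PU : P (\bigcup_m F m) = (pr P [set w | A (f (n w) w)])%:E.
  by rewrite -UF; exact: prE.
have H : (fun L => \sum_(0 <= i < L) P (F i))%E @ \oo --> P (\bigcup_m F m).
  exact: measure_semi_sigma_additive.
rewrite PU in H.
have E L : (\sum_(0 <= i < L) P (F i))%E = (geo B p L (\1_A))%:E.
  rewrite big_mkord /geo -sumEFin; apply: eq_bigr => m _.
  have nm : g_sigma_algebra_preimage n [set w | n w = m].
    by exists [set (m : nat)] => //; rewrite setTI.
  have fA : generated_sigma f (f m @^-1` A).
    by apply: sub_sigma_algebra; exists (m : nat) => //; exists A => //; rewrite setTI.
  rewrite /F (n_indep nm fA).
  rewrite n_geom [X in (_ * X)%E]prE ?pr_walk //.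
  exact: measurable_preimageT (measurable_walk m) mA.
move: H; rewrite (_ : (fun L => _) = fun L => (geo B p L (\1_A))%:E); last exact: funext.
by move=> /fine_cvgP[_].
Qed.

End uniform_updates.

(** * Tightness and weak limits *)

Section convergence.
Context {R : realType}.

Lemma cvg_norm_le (a : nat -> R) (l c : R) :
  a @ \oo --> l -> (forall k, `|a k| <= c) -> `|l| <= c.
Proof.
move=> al ac; have nl : (fun k => `|a k|) @ \oo --> `|l| by exact: cvg_norm.
rewrite -(cvg_lim (@Rhausdorff R) nl); apply: limr_le; last by apply: nearW.
by apply/cvg_ex; exists `|l|.
Qed.

Lemma cvg_sum_seq (I : eqType) (s : seq I) (a : nat -> I -> R) (l : I -> R) :
  (forall i, i \in s -> a ^~ i @ \oo --> l i) ->
  (fun k => \sum_(i <- s) a k i) @ \oo --> \sum_(i <- s) l i.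
Proof.
elim: s => [|i s IH] al.
  by rewrite big_nil; under eq_fun do rewrite big_nil; exact: cvg_cst.
rewrite big_cons; under eq_fun do rewrite big_cons.
apply: cvgD; first by apply: al; rewrite mem_head.
by apply: IH => j sj; apply: al; rewrite in_cons sj orbT.
Qed.

End convergence.

Section tails.
Context {R : realType} {disp : measure_display} {T : measurableType disp}.
Variable P : probability T R.

Lemma measurable_int_fibers (v : T -> int) (Q : int -> Prop) :
  (forall z, measurable [set w | v w = z]) -> measurable [set w | Q (v w)].
Proof.
move=> mv; rewrite (_ : [set w | _] = \bigcup_(z in [set z | Q z]) [set w | v w = z]).
  by apply: bigcup_countType_measurable => z _; exact: mv.
by apply/seteqP; split => [w Qw|w [z Qz /= ->]//]; exists (v w).
Qed.

Lemma int_tail_small (v : T -> int) (eps : R) :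
  (forall z, measurable [set w | v w = z]) -> 0 < eps ->
  exists l : nat, forall l', (l <= l')%N -> pr P [set w | l'%:Z < `|v w|] <= eps.
Proof.
move=> mv eps0; pose F (l : nat) := [set w | l%:Z < `|v w|].
have mF l : measurable (F l) by exact: (measurable_int_fibers (fun z => l%:Z < `|z|) mv).
have F0 : \bigcap_l F l = set0.
  apply/seteqP; split => // w Fw; have := Fw (absz (v w)) I.
  by rewrite /F /= abszE ltxx.
have dF : nonincreasing_seq F.
  move=> l l' ll'; apply/subsetPset => w; rewrite /F /=; apply: le_lt_trans.
  by rewrite lez_nat.
have := nonincreasing_cvg_mu (mu := P) _ mF _ dF; rewrite F0 measure0.
have PF0 : (P (F 0%N) < +oo)%E.
  by apply: le_lt_trans (probability_le1 P (mF 0%N)) _; rewrite ltry.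
move=> /(_ PF0 measurable0) /fine_cvgP[_ /cvgr0_norm_le /(_ eps eps0)[l _ H]].
exists l => l' ll'; have := H l' ll'; rewrite /= ger0_norm //; exact: pr_ge0.
Qed.

End tails.

Lemma finite_set_int_ball (l : nat) : finite_set [set v : int | `|v| <= l%:Z].
Proof.
pose s : seq int := [seq (i : nat)%:Z - l%:Z | i <- iota 0 (2 * l).+1].
apply: (sub_finite_set _ (finite_seq s)) => v /= vl.
have -> : v = (absz (v + l%:Z))%:Z - l%:Z by clear -vl; lia.
apply: (map_f (fun i : nat => i%:Z - l%:Z)).
by rewrite mem_iota /=; clear -vl; lia.
Qed.

Lemma compact_bounded_config d (l : site d -> nat) :
  compact [set h : config d | forall x, `|h x : int| <= (l x)%:Z].
Proof.
apply: (@tychonoff (site d) (fun=> discrete_topology int)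
  (fun x => [set v | `|v : int| <= (l x)%:Z])) => x.
apply: finite_compact.
exact: finite_set_int_ball.
Qed.

Section height_differences.
Context {R : realType} {d : nat}.

Let kappa : R := expR 1 * (2 * d).+1%:R.

(** Neighbour estimates are chained along a path from 0 to [x]: [k] counts its edges, and [r] is
    large enough for the box to contain it. *)
Lemma geo_difference (x : site d) : exists k r : nat, forall N (p : R) L,
  (r <= N)%N -> 0 < p < 1 ->
  geo (boxf N) p L (fun h : config d => `|(h x : int) - (h 0 : int)|%:~R)
    <= k%:R * (2 * (kappa + p * #|` boxf N : {fset site d}|%:R)).
Proof.
elim/site_ind: x => [|x y xy [k [r H]]].
  exists 0%N, 0%N => N p L _ p01; rewrite mul0r.
  rewrite (_ : (fun h => _) = (fun h : config d => 0 * (0 : R))).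
    by rewrite geoZ ?mul0r // card_boxf_gt0.
  by apply: funext => h; rewrite subrr normr0 mul0r.
exists k.+1, (maxn r (maxn (snorm x) (snorm y))) => N p L.
rewrite !geq_max => /and3P[rN xN yN] p01.
rewrite -natr1 mulrDl mul1r.
have g := @geo_nbr R d (boxf N) (card_boxf_gt0 N) p p01 L y x.
apply: le_trans (lerD (H N p L rN p01) (g _ _ _)); rewrite ?in_boxf //; last first.
  by rewrite nbrs_sym.
rewrite -(geoD (card_boxf_gt0 N)); apply: (geo_le (card_boxf_gt0 N) p01) => h.
by rewrite -intrD ler_int [leRHS]addrC; exact: ler_distD.
Qed.

End height_differences.

Section scaling_limit.
Context {R : realType} {d : nat} (p : nat -> R).
Hypothesis p01 : forall N, (1 <= N)%N -> 0 < p N < 1.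
Hypothesis p_upper : much_less p (fun N => N%:R ^- d).
Context (disp : nat -> measure_display) (T : forall N, measurableType (disp N))
  (P : forall N, probability (T N) R) (X : forall N, nat -> T N -> site d)
  (n : forall N, T N -> nat).
Hypothesis mX : forall N k, measurable_fun setT (@X N k).
Hypothesis mn : forall N, measurable_fun setT (@n N).
Let f N (m : nat) (w : T N) := discrete_bd (fun k => @X N k w) m.
Hypothesis X_unif : forall N k, (1 <= N)%N -> uniform_on (P N) (@X N k) (box d N).
Hypothesis X_indep : forall N, (1 <= N)%N ->
    mutually_independent (P N) (fun k => g_sigma_algebra_preimage (@X N k)).
Hypothesis n_geom : forall N, (1 <= N)%N -> geometric_law (P N) (@n N) (p N).
Hypothesis n_indep : forall N, (1 <= N)%N ->
    independent2 (P N) (g_sigma_algebra_preimage (@n N))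
      (generated_sigma (@f N)).
Let u N (w : T N) := recenter (@f N (@n N w) w).

Let mn_fiber N m : measurable [set w | @n N w = m].
Proof. by apply: (measurable_preimageT (A := [set m])) (@mn N) _. Qed.

Lemma measurable_u N : measurable_fun setT (@u N).
Proof.
apply: measurableT_comp; first exact: measurable_recenter.
by apply: measurable_stopped => // k; exact: mX.
Qed.

Let stopped N (A : set (config d)) : (1 <= N)%N -> measurable A ->
  geo (boxf N) (p N) ^~ (\1_A) @ \oo --> pr (P N) [set w | A (@f N (@n N w) w)].
Proof.
move=> N1 mA; apply: pr_stopped => //.
- by move=> k; exact: X_unif.
- exact: X_indep.
- exact: n_geom.
- exact: n_indep.
Qed.

(** For [N >= 1] one has 2N + 1 <= 3N; this is the origin of the factor [3 ^+ d]. *)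
Lemma mass_bound N : (1 <= N)%N ->
  p N * #|` boxf N : {fset site d}|%:R <= 3 ^+ d * (p N / N%:R ^- d).
Proof.
move=> N1; have /andP[p0 _] := p01 N1.
rewrite invrK mulrCA ler_pM2l // -exprMn -natrM -natrX ler_nat.
apply: leq_trans (card_boxf N) _; by have [->|d0] := posnP d; rewrite ?expn0 // leq_exp2r //; lia.
Qed.

Lemma difference_tail (x : site d) (eps : R) : 0 < eps ->
  exists l : nat, forall N, (1 <= N)%N ->
    pr (P N) [set w | l%:Z < `|@u N w x : int|] <= eps.
Proof.
move=> eps0.
have mu_fiber N z : measurable [set w | @u N w x = z].
  exact: measurable_fun_site (@measurable_u N).
have [k [r H]] := @geo_difference R d x.
have [N1 _ HN1] : \forall N \near \oo, `|p N / N%:R ^- d| <= 1.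
  by move/cvgr0_norm_le : p_upper; apply.
(* The bound of [geo_difference] once [p N] times the box volume is at most [3 ^+ d]. *)
pose c : R := k%:R * (2 * (expR 1 * (2 * d).+1%:R + 3 ^+ d)).
have c0 : 0 <= c by rewrite !mulr_ge0 ?addr_ge0 ?mulr_ge0 ?expR_ge0 ?exprn_ge0.
pose l0 := Num.bound (c / eps).
have big N l : (maxn 1 (maxn r N1) <= N)%N -> (l0 <= l)%N ->
    pr (P N) [set w | l%:Z < `|@u N w x : int|] <= eps.
  rewrite !geq_max => /and3P[N_1 rN NN1] l0l.
  pose A := [set h : config d | l%:Z < `|(h x : int) - (h 0 : int)|].
  have lA : local (snorm x) A.
    by move=> h h' hh'; rewrite /A /= !hh' ?snorm0.
  have mA := local_measurable lA.
  have cl0 : c / eps < l0%:R by rewrite archi_boundP // divr_ge0 // ltW.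
  have l_gt0 : 0 < l%:R :> R.
    apply: (@lt_le_trans _ _ l0%:R); last by rewrite ler_nat.
    by apply: le_lt_trans cl0; rewrite divr_ge0 // ltW.
  have lim := stopped N_1 mA.
  apply: cvgr_to_le lim _; apply: nearW => L.
  have D0 := @card_boxf_gt0 d N.
  (* Markov's inequality, carried out inside the truncated sum and uniformly in [L]. *)
  apply: (@le_trans _ _ (c / l%:R)).
    rewrite ler_pdivlMr // mulrC -(geoZ D0).
    apply: le_trans (_ : _ <= k%:R * (2 * (expR 1 * (2 * d).+1%:R +
        p N * #|` boxf N : {fset site d}|%:R))) _.
      apply: le_trans (H N (p N) L rN (p01 N_1)).
      apply: (geo_le D0 (p01 N_1)) => h; rewrite indicE.
      case: (boolP (h \in A)) => [|_]; last by rewrite mulr0 ler0z.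
      by rewrite inE /A /= mulr1 -[leLHS]/(l%:Z%:~R) ler_int => /ltW.
    rewrite ler_wpM2l // ler_wpM2l // lerD2l.
    apply: le_trans (mass_bound N_1) _.
    rewrite ler_piMr ?exprn_ge0 //; apply: le_trans (HN1 N NN1).
    exact: ler_norm.
  rewrite ler_pdivrMr // mulrC -ler_pdivrMr // ltW //.
  by apply: lt_le_trans cl0 _; rewrite ler_nat.
have /choice[g gP] : forall N, exists l : nat, forall l', (l <= l')%N ->
    pr (P N) [set w | l'%:Z < `|@u N w x : int|] <= eps.
  by move=> N; apply: int_tail_small.
(* The finitely many [N] below [N0] escape the uniform bound; each has its own threshold, and the
   maximum is taken. *)
pose N0 := maxn 1 (maxn r N1).
exists (maxn l0 (\max_(N < N0) g N))%N => N N_1.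
have [NN0|N0N] := ltnP N N0; last by apply: big => //; exact: leq_maxl.
apply: gP; rewrite leq_max; apply/orP; right.
exact: (leq_bigmax (F := fun N : 'I_N0 => g N) (Ordinal NN0)).
Qed.

Lemma tight_u : tight P [set N | (1 <= N)%N] (@u).
Proof.
move=> eps eps0.
(* A site with code k in the enumeration of Z^d is allotted the failure probability eps / 2^(k+1),
   so that the total is at most [eps]. *)
have /choice[l lP] : forall x : site d, exists l : nat, forall N, (1 <= N)%N ->
    pr (P N) [set w | l%:Z < `|@u N w x : int|] <= eps / (2 ^ (choice.pickle x).+1)%:R.
  by move=> x; apply: difference_tail; rewrite divr_gt0 // ltr0n expn_gt0.
exists [set h : config d | forall x, `|h x : int| <= (l x)%:Z].
  exact: compact_bounded_config.
move=> N N_1.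
pose E (x : site d) := [set w | (l x)%:Z < `|@u N w x : int|].
have mE x : measurable (E x).
  apply: (measurable_int_fibers (fun z => (l x)%:Z < `|z|)) => z.
  exact: measurable_fun_site (@measurable_u N).
pose F (k : nat) := \bigcup_(x in [set x : site d | choice.pickle x = k]) E x.
have mF k : measurable (F k) by apply: bigcup_countType_measurable => x _.
have KF : @u N @^-1` (~` [set h : config d | forall x, `|h x : int| <= (l x)%:Z])
    = \bigcup_k F k.
  apply/seteqP; split => [w /= /existsNP[x xl]|w [k _ [x _ Ex]] /(_ x)].
    by exists (choice.pickle x) => //; exists x => //; rewrite /E /= ltNge; apply/negP.
  by apply/negP; rewrite -ltNge.
rewrite KF.
have sub : (P N (\bigcup_k F k) <= \sum_(k <oo) P N (F k))%E.
  by apply: measure_sigma_subadditive => //; exact: bigcupT_measurable.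
apply: le_trans sub _.
apply: le_trans (epsilon_trick0 xpredT (ltW eps0)).
apply: lee_nneseries => [k _ _|k _]; first exact: measure_ge0.
have [[x xk]|nk] := pselect (exists x : site d, choice.pickle x = k).
  have -> : F k = E x.
    apply/seteqP; split => [w [y yk Ey]|w Ex]; last by exists x.
    by rewrite (pcan_inj choice.pickleK (etrans xk (esym yk))).
  by rewrite prE // lee_fin -xk; exact: lP.
have -> : F k = set0.
  by apply/seteqP; split => // w [x xk _]; apply: nk; exists x.
by rewrite measure0 lee_fin divr_ge0 // ltW.
Qed.

Section weak_limit.
Variables (phi : nat -> nat) (mu : probability (config d) R).
Hypothesis phi0 : (1 <= phi 0)%N.
Hypothesis phi_homo : {homo phi : i j / (i < j)%N}.
Hypothesis phi_cvg : weakly_converges (fun k => P (phi k)) (fun k => @u (phi k)) mu.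

Let phi_ge k : (k < phi k)%N.
Proof. by elim: k => // k IH; apply: leq_ltn_trans IH _; exact: phi_homo. Qed.

Let phi1 k : (1 <= phi k)%N. Proof. exact: leq_trans (phi_ge k). Qed.

Lemma local_cvg M (A : set (config d)) : local M A ->
  (fun k => pr (P (phi k)) [set w | A (@u (phi k) w)]) @ \oo --> pr mu A.
Proof.
move=> lA; have mA := local_measurable lA.
have := phi_cvg (continuous_local (R := R) lA); rewrite /= => H.
have /H {H} : exists M : R, forall h : config d, `|\1_A h : R| <= M.
  by have [_ [c cP]] := bmf_indic (R := R) mA; exists c.
have -> : (\int[mu]_h (\1_A h)%:E)%E = (pr mu A)%:E.
  by rewrite integral_indic // setIT; exact: prE.
rewrite (_ : (fun k => _) = fun k => (pr (P (phi k)) [set w | A (@u (phi k) w)])%:E).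
  by move=> /fine_cvgP[_].
apply: funext => k.
have mB : measurable [set w | A (@u (phi k) w)].
  exact: measurable_preimageT (@measurable_u _) mA.
transitivity (\int[P (phi k)]_w (\1_[set w | A (@u (phi k) w)] w)%:E)%E; last first.
  by rewrite integral_indic // setIT; exact: prE.
apply: eq_integral.
by move=> w _; rewrite (indic_preimage (R := R)).
Qed.

Lemma limit_pinned : pr mu [set h : config d | (h 0 : int) = 0] = 1.
Proof.
have l0 : local 0 [set h : config d | (h 0 : int) = 0].
  by move=> h h' hh' /= <-; rewrite hh' ?snorm0.
have H := local_cvg l0; apply: (cvg_unique _ H) => //.
rewrite (_ : (fun k => _) = fun=> 1); first exact: cvg_cst.
apply: funext => k; rewrite (_ : [set w | _] = setT) ?prT //.
by apply/seteqP; split => // w _ /=; rewrite /u /recenter subrr.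
Qed.

Lemma limit_gen_invariant : gen_invariant mu.
Proof.
move=> M B lB sB.
have ldx x : (snorm x <= M)%N -> local M.+1 (drop_at x @^-1` B).
  by move=> xM; apply: local_drop => //; exact: local_le (leqnSn M) lB.
pose a k x := pr (P (phi k)) [set w | (drop_at x @^-1` B) (@u (phi k) w)]
  - pr (P (phi k)) [set w | B (@u (phi k) w)].
have scvg : (fun k => \sum_(x <- boxf M) a k x) @ \oo -->
    \sum_(x <- boxf M) (pr mu (drop_at x @^-1` B) - pr mu B).
  apply: cvg_sum_seq => x; rewrite in_boxf => xM.
  by apply: cvgB; [exact: local_cvg (ldx x xM)|exact: local_cvg lB].
have bound k : (M <= k)%N -> `|\sum_(x <- boxf M) a k x| <=
    3 ^+ d * (p (phi k) / (phi k)%:R ^- d).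
  move=> Mk; apply: le_trans _ (mass_bound (phi1 k)).
  have D0 := @card_boxf_gt0 d (phi k).
  have MN : (M <= phi k)%N by apply: leq_trans Mk _; exact: ltnW.
  pose g L x := geo (boxf (phi k)) (p (phi k)) L (\1_B \o drop_at x)
    - geo (boxf (phi k)) (p (phi k)) L (\1_B).
  have gL L : `|\sum_(x <- boxf M) g L x| <=
      p (phi k) * #|` boxf (phi k) : {fset site d}|%:R.
    have G01 (h : config d) : 0 <= (\1_B h : R) <= 1.
      by rewrite indicE; case: (_ \in _); rewrite ?lexx ?ler01.
    apply: le_trans (geo_generator D0 (p01 (phi1 k)) L G01).
    (* The generator bound concerns all sites of [boxf (phi k)], but those outside [boxf M] leave
       the indicator of [B] unchanged. *)
    rewrite (big_fset_incl _ (boxf_sub MN)) // => x _.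
    rewrite in_boxf -ltnNge => Mx; rewrite /g (_ : _ \o _ = \1_B) ?subrr //.
    by apply: funext => h /=; rewrite (localn_drop_out h (localn_indic lB) Mx).
  apply: cvg_norm_le gL; apply: cvg_sum_seq => x; rewrite in_boxf => xM.
  have mBx := local_measurable (ldx x xM).
  apply: cvgB.
    rewrite (_ : (fun L => _) = fun L => geo (boxf (phi k)) (p (phi k)) L
        (\1_(drop_at x @^-1` B))); last first.
      by apply: funext => L; congr geo; apply: funext => h /=; rewrite (indic_preimage (R := R)).
    (* As [L] grows the truncated sums give the law of the stopped [f]; shift invariance turns it
       into that of [u]. *)
    have := stopped (phi1 k) mBx; congr (_ --> pr _ _).
    by apply: eq_set => w; rewrite /u (shift_inv_recenter _ (@shift_inv_drop d x B sB)).
  have := stopped (phi1 k) (local_measurable lB); congr (_ --> pr _ _).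
  by apply: eq_set => w; rewrite /u (shift_inv_recenter _ sB).
apply/eqP; rewrite -normr_le0; apply/ler_addgt0Pr => eps eps0; rewrite add0r.
have e3 : 0 < eps / 3 ^+ d by rewrite divr_gt0 // exprn_gt0.
have [N1 _ HN1] : \forall N \near \oo, `|p N / N%:R ^- d| <= eps / 3 ^+ d.
  by move/cvgr0_norm_le : p_upper; apply.
apply: cvgr_to_le (cvg_norm scvg) _.
exists (maxn M N1) => // k /=; rewrite geq_max => /andP[Mk N1k].
apply: le_trans (bound k Mk) _; rewrite mulrC -ler_pdivlMr ?exprn_gt0 //.
apply: le_trans (HN1 (phi k) _); first exact: ler_norm.
by rewrite /=; apply: leq_trans N1k _; exact: ltnW.
Qed.

End weak_limit.

End scaling_limit.

(** * Clocks in finite volume *)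

Lemma int_seq_stabilizes (a : nat -> int) (K : int) :
  {homo a : M M' / (M <= M')%N >-> M <= M'} -> (forall M, a M <= K) ->
  exists M0, forall M, (M0 <= M)%N -> a M = a M0.
Proof.
move=> amon aK.
suff H : forall k M1, K - a M1 <= k%:Z ->
    exists M0, forall M, (M0 <= M)%N -> a M = a M0.
  by apply: (H (absz (K - a 0%N)) 0%N); lia.
elim=> [|k IH] M1 aM1.
  by exists M1 => M M1M; have := amon _ _ M1M; have := aK M; lia.
have [H|/existsNP[M /not_implyP[M1M /eqP aM]]] :=
  pselect (forall M, (M1 <= M)%N -> a M = a M1); first by exists M1.
by apply: (IH M); have := amon _ _ M1M; lia.
Qed.

Section grid.
Context {R : realType} {d : nat}.
Implicit Types (c : site d -> set R) (D : {fset site d}) (h : config d) (t e : R).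

Definition locally_finite c :=
  (forall x s, c x s -> 0 <= s) /\ (forall x t, finite_set (c x `&` `[0, t])).

(** Open on the right, in accordance with [ring_times]: a ring at time [b] acts only after [b]. *)
Definition rings c D (a b : R) : set R :=
  [set s | a <= s < b /\ exists2 x, x \in D & c x s].

Lemma finite_rings c D a b : locally_finite c -> finite_set (rings c D a b).
Proof.
move=> [c0 cf]; apply: (@sub_finite_set _ _ (\bigcup_(x in [set` D]) (c x `&` `[0, b]))).
  move=> s [/andP[_ sb] [x xD cs]]; exists x => //; split => //.
  by rewrite /= in_itv /= (c0 _ _ cs) ltW.
by apply: bigcup_finite => // x _; exact: cf.
Qed.

Lemma ring_times_cat c D a b : locally_finite c -> 0 <= a -> a <= b ->
  ring_times c D b = ring_times c D a ++ sort <=%O (fset_set (rings c D a b)).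
Proof.
move=> lf a0 ab; apply: (@sorted_eq _ <=%O).
- exact: le_trans.
- exact: le_anti.
- exact: sort_le_sorted.
- rewrite sorted_pairwise; last exact: le_trans.
  rewrite pairwise_cat -!sorted_pairwise; try exact: le_trans.
  rewrite !sort_le_sorted !andbT; apply/allrelP => s s'.
  rewrite !mem_sort !in_fset_set; try exact: finite_rings.
  rewrite !inE => -[/andP[_ sa] _] [/andP[as' _] _].
  exact: le_trans (ltW sa) as'.
apply: uniq_perm.
- by rewrite sort_uniq fset_uniq.
- rewrite cat_uniq !sort_uniq !fset_uniq andbT /=; apply/hasPn => s.
  rewrite !mem_sort !in_fset_set; try exact: finite_rings.
  rewrite !inE => -[/andP[as' _] _]; apply/negP; rewrite inE => -[/andP[_ sa] _].
  by have := le_lt_trans as' sa; rewrite ltxx.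
move=> s; rewrite mem_cat !mem_sort !in_fset_set; try exact: finite_rings.
apply/idP/orP; rewrite !inE.
  move=> [/andP[s0 sb] cs]; have [sa|as'] := ltP s a; [left|right]; split => //.
    by rewrite s0.
  by rewrite as'.
case=> -[/andP[s1 s2] cs]; split => //.
  by rewrite s1 (lt_le_trans s2).
by rewrite s2 (le_trans a0).
Qed.

Lemma finite_bd0 c D h : finite_bd c D h 0 = h.
Proof.
rewrite /finite_bd /ring_times (_ : [set s | _] = set0) ?fset_set0 //.
by apply/seteqP; split => // s [/andP[s0 /(le_lt_trans s0)]]; rewrite ltxx.
Qed.

(** At most one ringing time, not one ringing site: simultaneous rings are performed together by
    [finite_bd], so the grid argument applies to every locally finite realization. *)
Definition sparse c D a b := forall s s', rings c D a b s -> rings c D a b s' -> s = s'.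

Lemma ring_count_gt0 c x a b : locally_finite c ->
  (0 < ring_count (c x) a b)%N <-> exists2 s, c x s & a <= s < b.
Proof.
move=> lf; have fin : finite_set (c x `&` `[a, b[).
  apply: sub_finite_set (finite_rings [fset x]%fset a b lf) => s [cs].
  by rewrite /= in_itv /= => sab; split => //; exists x; rewrite ?inE.
rewrite /ring_count cardfs_gt0; split.
  move=> /fset0Pn[s]; rewrite in_fset_set // inE => -[cs].
  by rewrite /= in_itv /= => sab; exists s.
move=> [s cs sab]; apply/fset0Pn; exists s; rewrite in_fset_set // inE.
by split => //; rewrite /= in_itv.
Qed.

Definition active c D a b : set (site d) :=
  [set x | x \in D /\ (0 < ring_count (c x) a b)%N].

Lemma finite_bd_interval c D h a b : locally_finite c -> 0 <= a -> a <= b ->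
  sparse c D a b ->
  finite_bd c D h b = update (active c D a b) (finite_bd c D h a).
Proof.
move=> lf a0 ab sp; rewrite {1}/finite_bd (ring_times_cat _ lf a0 ab) foldl_cat.
rewrite -/(finite_bd c D h a).
have [[s rs]|nrs] := pselect (exists s, rings c D a b s).
  have -> : rings c D a b = [set s].
    by apply/seteqP; split => [s' rs'|s' ->//]; exact: sp.
  rewrite fset_set1 /= (_ : sort _ _ = [:: s]); last first.
    apply: perm_small_eq => //; apply: uniq_perm => // [|u].
      by rewrite sort_uniq fset_uniq.
    by rewrite mem_sort !inE.
  congr (update _ _); apply/seteqP; split => x /= [xD].
    move=> cs; split => //; apply/(ring_count_gt0 x a b lf); exists s => //.
    by case: rs.
  move=> /(ring_count_gt0 x a b lf)[s' cs' sab']; split => //.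
  by rewrite (sp s s') //; split => //; exists x.
rewrite (_ : rings c D a b = set0); last first.
  by apply/seteqP; split => // s rs; apply: nrs; exists s.
rewrite fset_set0 /= (_ : active c D a b = set0) ?update_set0 //.
apply/seteqP; split => // x [xD /(ring_count_gt0 x a b lf)[s cs sab]].
by apply: nrs; exists s; split => //; exists x.
Qed.

(** The dynamics seen through ring counts on a grid, hence measurable in the clocks; it is exact
    once no cell contains two ringing times. *)
Fixpoint coarse c D e (m : nat) h : config d :=
  if m is k.+1 then
    update (active c D (k%:R * e) (k.+1%:R * e)) (coarse c D e k h)
  else h.

Lemma finite_bd_coarse c D e m h : locally_finite c -> 0 <= e ->
  (forall k, (k < m)%N -> sparse c D (k%:R * e) (k.+1%:R * e)) ->
  finite_bd c D h (m%:R * e) = coarse c D e m h.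
Proof.
move=> lf e0; elim: m => [_|m IH sp]; first by rewrite mul0r finite_bd0.
rewrite (@finite_bd_interval _ _ _ (m%:R * e)) //=.
- by rewrite IH // => k km; apply: sp; exact: ltnW.
- by rewrite mulr_ge0.
- by rewrite ler_wpM2r // ler_nat.
- exact: sp.
Qed.

Lemma separated (s : seq R) : exists2 g : R, 0 < g &
  {in s &, forall a b, `|a - b| < g -> a = b}.
Proof.
exists (\big[Num.min/1]_(a <- s) \big[Num.min/1]_(b <- s | b != a) `|a - b|).
  elim/big_ind: _ => // [u v u0 v0|a _]; first by rewrite lt_min u0.
  elim/big_ind: _ => // [u v u0 v0|b ba]; first by rewrite lt_min u0.
  by rewrite normr_gt0 subr_eq0 eq_sym.
move=> a b sa sb; apply: contraTeq => ab; rewrite -leNgt.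
pose F (a' : R) := \big[Num.min/1]_(b' <- s | b' != a') `|a' - b'|.
have h1 : \big[Num.min/1]_(a' <- s) F a' <= F a.
  exact: (@ge_bigmin_seq _ _ _ s 1 a xpredT F sa isT).
rewrite eq_sym in ab; apply: le_trans h1 _; rewrite /F.
exact: (@ge_bigmin_seq _ _ _ s 1 b (fun b' => b' != a) (fun b' => `|a - b'|) sb ab).
Qed.

(** There are finitely many ringing times before [t]; a mesh below their minimal gap separates
    them. *)
Lemma grid_sparse c D t : locally_finite c -> 0 < t ->
  exists m0, forall m, (m0 < m)%N -> forall k, (k < m)%N ->
    sparse c D (k%:R * (t / m%:R)) (k.+1%:R * (t / m%:R)).
Proof.
move=> lf t0; have [g g0 gP] := separated (fset_set (rings c D 0 t)).
exists (Num.bound (t / g)) => m m0m k km s s' rs rs'.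
have m0 : 0 < m%:R :> R by rewrite ltr0n; exact: leq_ltn_trans m0m.
have e0 : 0 < t / m%:R by rewrite divr_gt0.
have sub u : rings c D (k%:R * (t / m%:R)) (k.+1%:R * (t / m%:R)) u ->
    u \in fset_set (rings c D 0 t).
  move=> [/andP[u1 u2] cu]; rewrite in_fset_set ?inE; last exact: finite_rings.
  split => //; apply/andP; split.
    by apply: le_trans u1; rewrite mulr_ge0 // ltW.
  apply: lt_le_trans u2 _; rewrite mulrA ler_pdivrMr // mulrC ler_wpM2l ?(ltW t0) //.
  by rewrite ler_nat.
apply: gP; rewrite ?sub //.
apply: (@lt_trans _ _ (t / m%:R)).
  case: rs rs' => /andP[s1 s2] _ [/andP[s1' s2'] _].
  move: s2 s2'; rewrite -natr1 mulrDl mul1r => s2 s2'.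
  by rewrite ltr_norml; apply/andP; split; lra.
rewrite ltr_pdivrMr // mulrC -ltr_pdivrMr //.
apply: lt_trans (archi_boundP _) _; first by rewrite divr_ge0 // ltW.
by rewrite ltr_nat.
Qed.

Lemma sparse_sub c D D' a b : (D `<=` D')%fset -> sparse c D' a b -> sparse c D a b.
Proof.
move=> /fsubsetP DD' sp s s' [sab [x xD cs]] [s'ab [x' xD' cs']].
by apply: sp; split => //; [exists x|exists x'] => //; exact: DD'.
Qed.

Lemma le_coarse c D D' e m h x : (D `<=` D')%fset ->
  (coarse c D e m h x : int) <= coarse c D' e m h x.
Proof.
move=> /fsubsetP DD'; elim: m x => // m IH x /=; apply: le_update => //.
by move=> y [/DD' yD yc].
Qed.

(** Both processes are read on one grid fine enough for the larger set, where monotonicity is that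
    of single updates. *)
Lemma le_finite_bd c D D' t h x : locally_finite c -> 0 < t -> (D `<=` D')%fset ->
  (finite_bd c D h t x : int) <= finite_bd c D' h t x.
Proof.
move=> lf t0 DD'; have [m0 m0P] := grid_sparse D' lf t0.
have tm : t = m0.+1%:R * (t / m0.+1%:R) by rewrite mulrC divfK // pnatr_eq0.
rewrite tm !finite_bd_coarse //; first exact: le_coarse.
- by rewrite divr_ge0 // ltW.
- by move=> k km; exact: m0P.
- by rewrite divr_ge0 // ltW.
- by move=> k km; apply: sparse_sub DD' _; exact: m0P.
Qed.

Lemma continuous_bd_eq c h t x v :
  (exists D0 : {fset site d}, forall D, (D0 `<=` D)%fset -> finite_bd c D h t x = v) ->
  continuous_bd c h t x = v.
Proof.
move=> cv; rewrite /continuous_bd; case: xgetP => [u _|/(_ v)] //.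
move=> [D0 D0P]; case: cv => D1 D1P.
by rewrite -(D0P (D0 `|` D1)%fset) ?fsubsetUl // (D1P (D0 `|` D1)%fset) ?fsubsetUr.
Qed.

Lemma continuous_bd0 c h : continuous_bd c h 0 = h.
Proof.
apply: config_eq => x; apply: continuous_bd_eq.
by exists fset0 => D _; rewrite finite_bd0.
Qed.

(* By monotonicity in [D] the net of finite volume heights stabilizes as soon
   as it stays bounded along the boxes. *)
Lemma bounded_stabilizes c h t x (K : nat) : locally_finite c -> 0 < t ->
  (forall M, (finite_bd c (boxf M) h t x : int) <= K%:Z) ->
  exists M0, forall D, (boxf M0 `<=` D)%fset ->
    finite_bd c D h t x = continuous_bd c h t x.
Proof.
move=> lf t0 aK; pose a M : int := finite_bd c (boxf M) h t x.
have amon M M' : (M <= M')%N -> a M <= a M'.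
  by move=> MM'; apply: le_finite_bd => //; exact: boxf_sub.
have [M0 M0P] := int_seq_stabilizes amon aK.
have st D : (boxf M0 `<=` D)%fset -> finite_bd c D h t x = a M0.
  move=> M0D; have [M1 DM1] := fset_sub_boxf D.
  have DM : (D `<=` boxf (maxn M0 M1))%fset.
    by apply: fsubset_trans DM1 _; apply: boxf_sub; exact: leq_maxr.
  apply/eqP; rewrite eq_le -{1}(M0P (maxn M0 M1)) ?leq_maxl //.
  by rewrite /a !le_finite_bd.
exists M0 => D M0D; rewrite st //; apply/esym/continuous_bd_eq.
by exists (boxf M0).
Qed.

End grid.

(** * Measurability of the processes driven by the clocks *)

Section random_clocks.
Context {R : realType} {d : nat} {disp : measure_display} {T : measurableType disp}.
Variables (P : probability T R) (C : site d -> T -> set R) (h0 : T -> config d).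
Hypothesis C_poisson : forall x, poisson_process P 1 (C x).
Hypothesis mh0 : measurable_fun setT h0.
Implicit Types (D : {fset site d}) (t e : R).

Lemma clocks_locally_finite w : locally_finite (C^~ w).
Proof. by split => x; have [c0 cf _ _ _] := C_poisson x; [exact: c0|exact: cf]. Qed.

Lemma measurable_ring_count x a b k :
  measurable [set w | ring_count (C x w) a b = k].
Proof.
have [_ _ mc _ _] := C_poisson x.
exact: (measurable_preimageT (A := [set k])) (mc a b) _.
Qed.

Lemma measurable_update (A : T -> set (site d)) (h : T -> config d) :
  (forall x, measurable [set w | A w x]) -> measurable_fun setT h ->
  measurable_fun setT (fun w => update (A w) (h w)).
Proof.
move=> mA mh; apply: measurable_fun_config => x v.
have -> : [set w | update (A w) (h w) x = v] =
    ([set w | A w x] `&` [set w | drop_at x (h w) x = v]) `|`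
    (~` [set w | A w x] `&` [set w | h w x = v]).
  apply/seteqP; split => w; rewrite /update /= drop_same.
    case: (boolP (x \in A w)); first by rewrite inE; left.
    by rewrite notin_setE; right.
  by case=> -[Ax <-]; [rewrite ifT // inE|rewrite ifF //; apply/negP; rewrite inE].
apply: measurableU; apply: measurableI.
- exact: mA.
- apply: (measurable_fun_site (X := fun w => drop_at x (h w))).
  by apply: measurableT_comp mh; exact: measurable_drop.
- exact/measurableC/mA.
- exact: measurable_fun_site mh.
Qed.

Lemma measurable_active D a b x : measurable [set w | active (C^~ w) D a b x].
Proof.
have [xD|xD] := boolP (x \in D); last first.
  rewrite (_ : [set w | _] = set0) //; apply/seteqP; split => // w [].
  by rewrite (negbTE xD).
rewrite (_ : [set w | _] = ~` [set w | ring_count (C x w) a b = 0%N]).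
  exact/measurableC/measurable_ring_count.
apply/seteqP; split => w /=; first by case=> _; case: ring_count.
by move=> cw; split => //; rewrite lt0n; apply/eqP.
Qed.

Lemma measurable_coarse D e m :
  measurable_fun setT (fun w => coarse (C^~ w) D e m (h0 w)).
Proof.
elim: m => [//|m IH]; apply: measurable_update => // x.
exact: measurable_active.
Qed.

(** For every realization the grid approximations are eventually equal to the process, so its fibres
    are countable combinations of theirs. *)
Lemma measurable_finite_bd D t : 0 <= t ->
  measurable_fun setT (fun w => finite_bd (C^~ w) D (h0 w) t).
Proof.
rewrite le_eqVlt => /predU1P[<-|t0].
  by under eq_fun do rewrite finite_bd0.
pose Z m w := coarse (C^~ w) D (t / m%:R) m (h0 w).
have ZE w : exists m0, forall m, (m0 < m)%N -> Z m w = finite_bd (C^~ w) D (h0 w) t.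
  have [m0 m0P] := grid_sparse D (clocks_locally_finite w) t0.
  exists m0 => m m0m; have mn0 : m%:R != 0 :> R.
    by rewrite pnatr_eq0 -lt0n; exact: leq_ltn_trans m0m.
  have tm : m%:R * (t / m%:R) = t by rewrite mulrC divfK.
  rewrite -[t in RHS]tm finite_bd_coarse //; first exact: clocks_locally_finite.
    by rewrite divr_ge0 // ltW.
  exact: m0P.
apply: measurable_fun_config => x v.
have -> : [set w | finite_bd (C^~ w) D (h0 w) t x = v] =
    \bigcup_m0 \bigcap_(m in [set m | (m0 < m)%N]) [set w | Z m w x = v].
  apply/seteqP; split => [w|w [m0 _ Hm]] /=.
    by have [m0 m0P] := ZE w => fv; exists m0 => // m /m0P /= ->.
  have [m1 m1P] := ZE w.
  rewrite -(m1P (maxn m0 m1).+1) ?ltnS ?leq_maxr //.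
  by apply: Hm; rewrite /= ltnS leq_maxl.
apply: bigcupT_measurable => m0; apply: bigcap_countType_measurable => m _.
by apply: measurable_fun_site; exact: measurable_coarse.
Qed.

(** There are countably many finite sets of sites, so [L v], the event that the net stabilizes at
    [v], is measurable. The complement of all of them receives the default value 0. *)
Lemma measurable_continuous_bd t : 0 <= t ->
  measurable_fun setT (fun w => continuous_bd (C^~ w) (h0 w) t).
Proof.
move=> t0; apply: measurable_fun_config => x v.
pose L (v : int) := \bigcup_(D0 : {fset site d}) \bigcap_(D in [set D | (D0 `<=` D)%fset])
  [set w | finite_bd (C^~ w) D (h0 w) t x = v].
have mL z : measurable (L z).
  apply: bigcup_countType_measurable => D0 _; apply: bigcap_countType_measurable => D _.
  exact: (measurable_fun_site x z (measurable_finite_bd D t0)).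
have LE z w : L z w <-> exists D0 : {fset site d}, forall D, (D0 `<=` D)%fset ->
    finite_bd (C^~ w) D (h0 w) t x = z.
  by split => [[D0 _ H]|[D0 H]]; exists D0.
have -> : [set w | continuous_bd (C^~ w) (h0 w) t x = v] =
    L v `|` ([set w | v = 0] `&` \bigcap_z ~` L z).
  apply/seteqP; split => [w /= <-|w].
    have [[z Lz]|nL] := pselect (exists z, L z w).
      by left; rewrite (continuous_bd_eq ((LE z w).1 Lz)).
    right; split => [|z _ Lz]; last by apply: nL; exists z.
    rewrite /= /continuous_bd; case: xgetP => // z _ /(LE z w) Lz.
    by exfalso; apply: nL; exists z.
  case=> [/LE/continuous_bd_eq//|[/= -> nL]].
  rewrite /continuous_bd; case: xgetP => // z _ /(LE z w) Lz.
  by case: (nL z).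
apply: measurableU => //; apply: measurableI.
  have [->|v0] := pselect (v = 0); first by rewrite (_ : [set w | _] = setT) //; apply/seteqP.
  by rewrite (_ : [set w | _] = set0) //; apply/seteqP; split.
by apply: bigcap_countType_measurable => z _; exact: measurableC.
Qed.

End random_clocks.

(** * Ring patterns on a time grid *)

Section patterns.
Context {R : realType} {d : nat} {disp : measure_display} {T : measurableType disp}.
Variables (P : probability T R) (C : site d -> T -> set R) (h0 : T -> config d)
  (mu : probability (config d) R).
Hypothesis C_poisson : forall x, poisson_process P 1 (C x).
Hypothesis C_indep : mutually_independent P (fun x => clock_sigma (C x)).
Hypothesis h0_law : has_law P h0 mu.
Hypothesis h0_indep : independent2 P (g_sigma_algebra_preimage h0)
  <<s \bigcup_x clock_sigma (C x) >>.

Variables (D : {fset site d}) (e : R).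
Hypothesis e0 : 0 < e.

Let cnt (k : nat) x w := ring_count (C x w) (k%:R * e) (k.+1%:R * e).
Let tgt (o : option (site d)) x : nat := (o == Some x).

(* A pattern lists, for consecutive intervals of the grid, the unique site of
   [D] whose clock rings once, or [None] when no clock of [D] rings. *)
Definition pattern := seq (option (site d)).

Implicit Type om : pattern.

(** Constraints are grouped by site: independence between intervals comes from the increments of one
    clock, independence between sites from [C_indep]. *)
Definition event_at om x : set T :=
  \bigcap_(k in [set` iota 0 (size om)]) [set w | cnt k x w = tgt (nth None om k) x].

Definition event om : set T := \bigcap_(x in [set` D]) event_at om x.

(** The Poisson probability that, during an interval of length [e], the clocks of [D] stay silent,
    or a prescribed one rings once and the others stay silent. *)
Definition weight (o : option (site d)) : R :=
  expR (- e) ^+ #|` D| * (if o is Some _ then e else 1).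

Definition options : pattern := None :: [seq Some x | x <- D].

Lemma pr_cnt k x j : (j <= 1)%N ->
  pr P [set w | cnt k x w = j] = expR (- e) * e ^+ j.
Proof.
move=> j1; have [_ _ _ cp _] := C_poisson x.
rewrite /pr cp /=; last first.
  by rewrite mulr_ge0 ?(ltW e0) //= ltr_pM2r // ltr_nat.
rewrite (_ : 1 * _ = e); last by rewrite -natr1; ring.
rewrite /poisson_pmf e0; move: j1; rewrite leq_eqVlt ltnS leqn0.
by case/orP => /eqP ->; rewrite ?fact0 ?fact1 invr1 mulr1 mulrC.
Qed.

Let measurable_cnt k x j : measurable [set w | cnt k x w = j].
Proof. exact: (measurable_ring_count C_poisson). Qed.

Lemma measurable_event_at om x : measurable (event_at om x).
Proof. by apply: bigcap_countType_measurable => k _; exact: measurable_cnt. Qed.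

Lemma measurable_event om : measurable (event om).
Proof. by apply: bigcap_countType_measurable => x _; exact: measurable_event_at. Qed.

Lemma clock_sigma_event_at om x : clock_sigma (C x) (event_at om x).
Proof.
pose G := \bigcup_i g_sigma_algebra_preimage
  ((fun (ab : R * R) w => ring_count (C x w) ab.1 ab.2) i).
apply: (@bigcap_countType_measurable _ (g_sigma_algebraType G)) => k _.
apply: sub_sigma_algebra; exists (k%:R * e, k.+1%:R * e) => //.
by exists [set tgt (nth None om k) x] => //; rewrite setTI.
Qed.

Lemma pr_event_at om x :
  pr P (event_at om x) = \prod_(o <- om) (expR (- e) * e ^+ tgt o x).
Proof.
have [_ _ _ _ ci] := C_poisson x.
have t0 : 0 <= 0%:R * e by rewrite mul0r.
have tm : nondecreasing_seq (fun k => k%:R * e).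
  by move=> k k' kk'; rewrite ler_wpM2r ?(ltW e0) // ler_nat.
rewrite (mutually_independent_seq (ci _ t0 tm)) ?iota_uniq //.
- rewrite (big_nth None) /index_iota subn0; apply: eq_bigr => k _.
  by apply: pr_cnt; rewrite /tgt; case: (_ == _).
- by move=> k _; exists [set tgt (nth None om k) x] => //; rewrite setTI.
Qed.

Lemma prod_weight o : o \in options ->
  \prod_(x <- D) (expR (- e) * e ^+ tgt o x) = weight o.
Proof.
rewrite big_split /= big_const_seq count_predT -Monoid.iteropE /=.
rewrite /weight -/(GRing.exp _ _) => oo; congr (_ * _).
move: oo; rewrite inE => /predU1P[->|/mapP[x xD ->]].
  by rewrite big1.
rewrite (bigD1_seq x) ?fset_uniq //= {1}/tgt eqxx expr1 big1 ?mulr1 // => y yx.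
by rewrite /tgt (_ : Some x == Some y = false) // ; apply/negbTE; rewrite eq_sym.
Qed.

Lemma pr_event om : {subset om <= options} -> pr P (event om) = \prod_(o <- om) weight o.
Proof.
move=> oo; rewrite (mutually_independent_seq C_indep) ?fset_uniq //.
- under eq_bigr do rewrite pr_event_at.
  rewrite exchange_big /= big_seq [RHS]big_seq; apply: eq_bigr => o /oo.
  exact: prod_weight.
- by move=> x _; exact: clock_sigma_event_at.
- by move=> x _; exact: measurable_event_at.
Qed.

Lemma pr_event_init om (A : set (config d)) : {subset om <= options} -> measurable A ->
  pr P (event om `&` h0 @^-1` A) = \prod_(o <- om) weight o * pr mu A.
Proof.
move=> oo mA; rewrite setIC /pr h0_indep.
- rewrite fineM; first by rewrite mulrC -/(pr P _) pr_event // h0_law.2.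
    by rewrite h0_law.2 // fin_num_measure.
  by rewrite fin_num_measure //; exact: measurable_event.
- by exists A => //; rewrite setTI.
- apply: (@bigcap_countType_measurable _
    (g_sigma_algebraType (\bigcup_x clock_sigma (C x)))) => x _.
  by apply: sub_sigma_algebra; exists x => //; exact: clock_sigma_event_at.
Qed.

Definition move_at (o : option (site d)) (h : config d) : config d :=
  if o is Some x then drop_at x h else h.

Definition play om (h : config d) : config d := foldl (fun h o => move_at o h) h om.

Fixpoint patterns m : seq pattern :=
  if m is k.+1 then [seq rcons om o | om <- patterns k, o <- options] else [:: [::]].

Lemma patternsP m om : om \in patterns m -> size om = m /\ {subset om <= options}.
Proof.
elim: m om => [|m IH] om; first by rewrite inE => /eqP ->.
case/allpairsP => -[om' o] [/= /IH[<- sub] oo ->]; split; first exact: size_rcons.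
by move=> o'; rewrite mem_rcons inE => /predU1P[->//|/sub].
Qed.

Lemma uniq_patterns m : uniq (patterns m).
Proof.
elim: m => // m IH; apply: allpairs_uniq => //.
  rewrite /options cons_uniq map_inj_uniq ?fset_uniq ?andbT; last by move=> x y [].
  by apply/mapP => -[].
by move=> [om o] [om' o'] _ _ /= /rcons_inj[-> ->].
Qed.

(** The counts on [D] determine the pattern, because its entries are [None] or sites of [D]. *)
Lemma event_disjoint m :
  {in patterns m &, forall om om', om != om' -> event om `&` event om' = set0}.
Proof.
move=> om om' /patternsP[sm oo] /patternsP[sm' oo'] neq.
apply/seteqP; split => // w [Hw Hw']; case/eqP: neq.
apply: (@eq_from_nth _ None); first by rewrite sm sm'.
move=> k km; have km' : (k < size om')%N by rewrite sm' -sm.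
have E x : x \in D -> tgt (nth None om k) x = tgt (nth None om' k) x.
  move=> xD; have <- : cnt k x w = tgt (nth None om k) x.
    by apply: (Hw x xD k); rewrite /= mem_iota.
  by apply: (Hw' x xD k); rewrite /= mem_iota.
have := oo _ (mem_nth None km); have := oo' _ (mem_nth None km').
move: E; rewrite /tgt.
case: (nth None om k) (nth None om' k) => [x|] [x'|] // E.
- rewrite !inE /= => _ /mapP[y yD [xy]].
  by have := E x; rewrite xy yD eqxx => /(_ isT); case: eqP => // ->.
- rewrite !inE /= => _ /mapP[y yD [xy]].
  by have := E x; rewrite xy yD eqxx => /(_ isT).
- rewrite !inE /= => /mapP[y yD [xy]] _.
  by have := E x'; rewrite xy yD eqxx => /(_ isT).
Qed.

Lemma event_sparse om w k : event om w -> (k < size om)%N ->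
  sparse (C^~ w) D (k%:R * e) (k.+1%:R * e).
Proof.
move=> Ew km.
have lf := clocks_locally_finite C_poisson w.
have cE x : x \in D -> cnt k x w = tgt (nth None om k) x.
  by move=> xD; apply: (Ew x xD k); rewrite /= mem_iota.
have act x s : x \in D -> C x w s -> k%:R * e <= s < k.+1%:R * e ->
    nth None om k = Some x.
  move=> xD cs sk; apply/eqP; have := cE x xD; rewrite /tgt; case: eqP => // _ c0.
  have : (0 < cnt k x w)%N by apply/(ring_count_gt0 x _ _ lf); exists s.
  by rewrite c0.
move=> s s' [sk [x xD cs]] [s'k [x' xD' cs']].
have ox := act x s xD cs sk; have := act x' s' xD' cs' s'k.
rewrite ox => -[xx']; rewrite -{}xx' {x' xD'} in cs'.
have := cE x xD; rewrite ox /tgt eqxx /cnt /ring_count => /eqP/cardfs1P[v vE].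
have mem u : C x w u -> k%:R * e <= u < k.+1%:R * e -> u = v.
  move=> cu uk; apply/eqP; rewrite -in_fset1 -vE in_fset_set.
    by rewrite inE; split => //; rewrite /= in_itv.
  apply: sub_finite_set (finite_rings [fset x]%fset (k%:R * e) (k.+1%:R * e) lf) => u' [cu'].
  by rewrite /= in_itv /= => uk'; split => //; exists x; rewrite ?inE.
by rewrite (mem s) // (mem s').
Qed.

Lemma event_rcons om o w : event (rcons om o) w ->
  event om w /\ (forall x, x \in D -> cnt (size om) x w = tgt o x).
Proof.
move=> Ew; split => x xD.
  move=> k; rewrite /= mem_iota /= add0n => km.
  have := Ew x xD k; rewrite /= mem_iota size_rcons add0n /= ltnS nth_rcons km.
  by apply; exact: ltnW.
have := Ew x xD (size om); rewrite /= mem_iota size_rcons add0n /= nth_rcons.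
by rewrite ltnn eqxx ltnSn; exact.
Qed.

Lemma coarse_event om w h : {subset om <= options} -> event om w ->
  coarse (C^~ w) D e (size om) h = play om h.
Proof.
elim/last_ind: om => [//|om o IH] oo /event_rcons[Ew cE].
have oom : {subset om <= options}.
  by move=> o' o'om; apply: oo; rewrite mem_rcons inE o'om orbT.
rewrite size_rcons /play foldl_rcons -/(play om h) /= IH //.
move: cE; have := oo o; rewrite mem_rcons mem_head => /(_ isT).
rewrite inE => /predU1P[->|/mapP[x xD ->]] cE.
  rewrite (_ : active _ _ _ _ = set0) ?update_set0 //.
  by apply/seteqP; split => // x [xD]; rewrite -/(cnt (size om) x w) cE.
rewrite /move_at /drop_at; congr (update _ _).
apply/seteqP; split => y /=.
  move=> [yD]; rewrite -/(cnt (size om) y w) cE // /tgt.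
  by case: eqP => // -[].
by move=> ->; split => //; rewrite -/(cnt (size om) x w) cE // /tgt eqxx.
Qed.

Lemma finite_bd_event om w h : {subset om <= options} -> event om w ->
  finite_bd (C^~ w) D h ((size om)%:R * e) = play om h.
Proof.
move=> oo Ew; rewrite finite_bd_coarse.
- exact: coarse_event.
- exact: (clocks_locally_finite C_poisson w).
- exact: ltW.
- by move=> k km; exact: event_sparse Ew km.
Qed.

(** The transition over one interval restricted to at most one ring in [D]. It loses mass, as
    several rings are discarded. *)
Definition clock_op (G : config d -> R) : config d -> R :=
  fun h => expR (- e) ^+ #|` D| * (G h + e * \sum_(x <- D) G (drop_at x h)).

Lemma sum_patterns m (G : config d -> R) h :
  \sum_(om <- patterns m) \prod_(o <- om) weight o * G (play om h) =
  iter m clock_op G h.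
Proof.
elim: m => [|m IH] in G *; first by rewrite big_seq1 big_nil mul1r.
have -> : patterns m.+1 = [seq rcons om o | om <- patterns m, o <- options] by [].
rewrite iterSr -IH big_allpairs_dep; apply: eq_bigr => om _.
have pr_rcons o : \prod_(o' <- rcons om o) weight o' = \prod_(o' <- om) weight o' * weight o.
  by rewrite -cats1 big_cat /= big_seq1.
have play_rcons o : play (rcons om o) h = move_at o (play om h).
  by rewrite /play foldl_rcons.
rewrite big_cons big_map pr_rcons play_rcons.
transitivity (\prod_(o <- om) weight o * weight None * G (play om h) +
    \sum_(x <- D) \prod_(o <- om) weight o * weight (Some x) * G (drop_at x (play om h))).
  by congr (_ + _); apply: eq_bigr => x _; rewrite pr_rcons play_rcons.
rewrite [RHS](_ : _ = \prod_(o <- om) weight o * weight None * G (play om h) +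
    (\prod_(o <- om) weight o * (expR (- e) ^+ #|` D| * e)) *
      \sum_(x <- D) G (drop_at x (play om h))).
  by congr (_ + _); rewrite mulr_sumr.
by rewrite /clock_op [weight None]/weight; ring.
Qed.

Lemma measurable_play om : measurable_fun setT (play om).
Proof.
elim/last_ind: om => [|om o IH]; first exact: measurable_id.
rewrite (_ : play _ = move_at o \o play om).
  apply: measurableT_comp IH; case: o => [x|]; last exact: measurable_id.
  exact: measurable_drop.
by apply: funext => h; rewrite /play foldl_rcons.
Qed.

Lemma pr_patterns m (B : set (config d)) : measurable B ->
  pr P (\bigcup_(om in [set` patterns m]) event om `&`
        [set w | B (finite_bd (C^~ w) D (h0 w) (m%:R * e))]) =
  mean mu (iter m clock_op (\1_B)).
Proof.
move=> mB.
have mp om : measurable (play om @^-1` B).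
  exact: measurable_preimageT (measurable_play om) mB.
rewrite (_ : iter _ _ _ = fun h => \sum_(om <- patterns m)
    \prod_(o <- om) weight o * \1_(play om @^-1` B) h); last first.
  by apply: funext => h; rewrite -sum_patterns; apply: eq_bigr => om _; rewrite indic_preimage.
rewrite mean_sum; last by move=> om; exact: bmf_indic.
have mE om : measurable (event om `&` h0 @^-1` (play om @^-1` B)).
  apply: measurableI; first exact: measurable_event.
  exact: measurable_preimageT h0_law.1 (mp om).
rewrite (_ : _ `&` _ = \bigcup_(om in [set` patterns m])
    (event om `&` h0 @^-1` (play om @^-1` B))).
  rewrite pr_bigcup_seq //; first last.
  - by move=> om om' pm pm' neq; rewrite setIACA (event_disjoint pm pm') // set0I.
  - exact: uniq_patterns.
  rewrite big_seq [RHS]big_seq; apply: eq_bigr => om /patternsP[_ oo].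
  by rewrite pr_event_init // mean_indic.
have fE om w : om \in patterns m -> event om w ->
    finite_bd (C^~ w) D (h0 w) (m%:R * e) = play om (h0 w).
  by move=> /patternsP[<- oo] Ew; exact: finite_bd_event.
apply/seteqP; split => [w [[om pm Ew] Bw]|w [om pm [Ew Bw]]].
  by exists om => //; split => //; rewrite /preimage /= -(fE om w).
by split; [exists om|rewrite /= (fE om w)].
Qed.

End patterns.

(** * Comparison of the clocks with Euler steps *)

Section clock_compare.
Context {R : realType} {d : nat}.
Variables (D : {fset site d}) (e : R).
Hypothesis e0 : 0 <= e.
Implicit Types (G : config d -> R) (h : config d).

Let s : R := e * #|` D|%:R.

Let s0 : 0 <= s. Proof. by rewrite mulr_ge0. Qed.

Let expRs : expR (- e) ^+ #|` D| = expR (- s).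
Proof. by rewrite -expRM_natl mulrN mulrC. Qed.

Let expR_sub1 : 0 <= expR (- s) - (1 - s) <= s ^+ 2.
Proof.
have s1 : 0 < 1 + s by apply: ltr_pwDl.
have E1 : expR (- s) * (1 + s) <= 1.
  by rewrite expRN mulrC ler_pdivrMr ?expR_gt0 // mul1r expR_ge1Dx.
have E2 := expR_ge1Dx (- s); apply/andP; split; first by rewrite subr_ge0.
(* The upper bound reduces to (1 - s + s^2)(1 + s) = 1 + s^3, which is at least 1. *)
rewrite lerBlDr -(ler_pM2r s1); apply: le_trans E1 _.
rewrite [leRHS](_ : _ = 1 + s ^+ 3); last by ring.
by rewrite lerDl exprn_ge0.
Qed.

Let sum_drop_le G c h : (forall h, `|G h| <= c) ->
  `|e * \sum_(x <- D) G (drop_at x h)| <= s * c.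
Proof.
move=> Gc; rewrite normrM (ger0_norm e0) /s -mulrA ler_wpM2l //.
apply: le_trans (ler_norm_sum _ _ _) _.
apply: le_trans (ler_sum _ (fun x _ => Gc _)) _.
by rewrite big_const_seq count_predT iter_addr_0 mulr_natl.
Qed.

Lemma clock_op_contract G1 G2 c : (forall h, `|G1 h - G2 h| <= c) ->
  forall h, `|clock_op D e G1 h - clock_op D e G2 h| <= c.
Proof.
move=> Gc h; rewrite /clock_op expRs.
have -> : expR (- s) * (G1 h + e * \sum_(x <- D) G1 (drop_at x h)) -
    expR (- s) * (G2 h + e * \sum_(x <- D) G2 (drop_at x h)) =
    expR (- s) * ((G1 h - G2 h) + e * \sum_(x <- D) (G1 (drop_at x h) - G2 (drop_at x h))).
  by rewrite sumrB; ring.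
rewrite normrM ger0_norm ?expR_ge0 // expRN mulrC ler_pdivrMr ?expR_gt0 //.
have c0 : 0 <= c by exact: le_trans (Gc h).
apply: (@le_trans _ _ (c * (1 + s))).
  rewrite (le_trans (ler_normD _ _)) // mulrDr mulr1 lerD //.
  by rewrite [leRHS]mulrC (sum_drop_le h (G := fun h => G1 h - G2 h)).
by rewrite ler_wpM2l // expR_ge1Dx.
Qed.

(** One [s ^+ 2] is the second order error of [expR (- s)] on the idle term; the other is the
    product of [1 - expR (- s)] and the size of the jump term, both at most [s]. *)
Lemma clock_op_step G h : (forall h, `|G h| <= 1) ->
  `|clock_op D e G h - step e D G h| <= 2 * s ^+ 2.
Proof.
move=> G1; rewrite /clock_op expRs stepE -/s.
have -> : expR (- s) * (G h + e * \sum_(x <- D) G (drop_at x h)) -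
    ((1 - s) * G h + e * \sum_(x <- D) G (drop_at x h)) =
    (expR (- s) - (1 - s)) * G h - (1 - expR (- s)) * (e * \sum_(x <- D) G (drop_at x h)).
  by ring.
have /andP[u0 u1] := expR_sub1.
have v0 : 0 <= 1 - expR (- s) by rewrite subr_ge0 -[leRHS]expR0 ler_expR oppr_le0.
rewrite (le_trans (ler_normB _ _)) // [leRHS]mulrDl !mul1r lerD //.
  rewrite normrM (ger0_norm u0); apply: le_trans u1.
  by rewrite ler_piMr.
rewrite normrM (ger0_norm v0) expr2; apply: ler_pM => //.
  by rewrite lerBlDr -lerBlDl; exact: expR_ge1Dx.
by have := sum_drop_le h G1; rewrite mulr1.
Qed.

Lemma clock_compare m G h : s <= 1 -> (forall h, `|G h| <= 1) ->
  `|iter m (clock_op D e) G h - iter m (step e D) G h| <= m%:R * (2 * s ^+ 2).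
Proof.
move=> s1 G1; apply: iter_compare; first exact: clock_op_contract.
move=> k km h'; apply: clock_op_step; exact: iter_step_norm.
Qed.

Lemma bmf_iter (A : (config d -> R) -> config d -> R) m G :
  (forall G, bounded_mfun G -> bounded_mfun (A G)) -> bounded_mfun G -> bounded_mfun (iter m A G).
Proof. by move=> HA bG; elim: m => //= m; exact: HA. Qed.

Lemma bmf_clock_op G : bounded_mfun G -> bounded_mfun (clock_op D e G).
Proof.
move=> bG; have bS : bounded_mfun (fun h => \sum_(x <- D) G (drop_at x h)).
  by apply: bmf_sum => x; exact: (bmf_drop x bG).
have := bmf_lin (expR (- e) ^+ #|` D|) (bmf_lin e bS bG) (bmf_cst 0).
congr bounded_mfun; apply: funext => h; rewrite /clock_op addr0; congr (_ * _).
by rewrite addrC.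
Qed.

End clock_compare.

Section finite_volume.
Context {R : realType} {d : nat} {disp : measure_display} {T : measurableType disp}.
Variables (P : probability T R) (C : site d -> T -> set R) (h0 : T -> config d)
  (mu : probability (config d) R).
Hypothesis C_poisson : forall x, poisson_process P 1 (C x).
Hypothesis C_indep : mutually_independent P (fun x => clock_sigma (C x)).
Hypothesis h0_law : has_law P h0 mu.
Hypothesis h0_indep : independent2 P (g_sigma_algebra_preimage h0)
  <<s \bigcup_x clock_sigma (C x) >>.

Variable t : R.
Hypothesis t0 : 0 < t.

Let fb (D : {fset site d}) w := finite_bd (C^~ w) D (h0 w) t.

Let mfb D : measurable_fun setT (fb D).
Proof. exact: (measurable_finite_bd C_poisson h0_law.1 D (ltW t0)). Qed.

(** The constant 4 is 2 + 2: the operator error on [B], and the probability that some interval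
    contains several rings in [D]. *)
Lemma pr_finite_bd D m (B : set (config d)) : measurable B -> (0 < m)%N ->
  t * #|` D|%:R <= m%:R ->
  `|pr P (fb D @^-1` B) - mean mu (iter m (step (t / m%:R) D) (\1_B))|
    <= 4 * (t * #|` D|%:R) ^+ 2 / m%:R.
Proof.
move=> mB m0 tm; pose e := t / m%:R; rewrite -/e.
have mR : 0 < m%:R :> R by rewrite ltr0n.
have e0 : 0 < e by rewrite divr_gt0.
have te : m%:R * e = t by rewrite mulrC divfK // gt_eqF.
set s := e * #|` D|%:R.
have s1 : s <= 1 by rewrite /s /e mulrAC ler_pdivrMr // mul1r.
pose E := \bigcup_(om in [set` patterns D m]) event C D e om.
have mE : measurable E.
  by apply: bigcup_countType_measurable => om _; exact: measurable_event.
have mf A : measurable A -> measurable (fb D @^-1` A).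
  by move=> mA; exact: measurable_preimageT (mfb D) mA.
have prE_B A : measurable A -> pr P (E `&` fb D @^-1` A) =
    mean mu (iter m (clock_op D e) (\1_A)).
  move=> mA.
  by rewrite -(pr_patterns C_poisson C_indep h0_law h0_indep D e0 m mA) te.
have ind1 A h : `|\1_A h : R| <= 1.
  by rewrite indicE; case: (_ \in _); rewrite ?normr1 ?normr0.
have cmp A : measurable A -> `|pr P (E `&` fb D @^-1` A) -
    mean mu (iter m (step e D) (\1_A))| <= m%:R * (2 * s ^+ 2).
  move=> mA; rewrite prE_B //; apply: mean_dist => [||h].
  - by apply: bmf_iter (bmf_indic mA); exact: bmf_clock_op.
  - by apply: bmf_iter (bmf_indic mA); exact: bmf_step.
  - by apply: clock_compare => //; exact: ltW.
(* The comparison applied to the sure event: Euler steps fix the constant 1, so the mass missing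
   from [E] obeys the same error bound. *)
have prE1 : 1 - pr P E <= m%:R * (2 * s ^+ 2).
  have := cmp setT measurableT; rewrite preimage_setT setIT.
  rewrite (_ : iter m _ _ = fun=> 1); last first.
    apply: funext => h; elim: (m) h => [|k IH] h; first by rewrite indicT.
    rewrite iterS /step IH big1 ?mulr0 ?addr0 // => x _.
    by rewrite IH subrr.
  have -> : mean mu (fun=> 1) = 1 :> R.
    by rewrite /mean Rintegral_cst // -/(pr mu setT) prT mulr1.
  by rewrite distrC; apply: le_trans; exact: ler_norm.
have -> : 4 * (t * #|` D|%:R) ^+ 2 / m%:R = m%:R * (2 * s ^+ 2) + m%:R * (2 * s ^+ 2).
  rewrite /s -te; field.
  by rewrite gt_eqF.
apply: le_trans (ler_distD (pr P (E `&` fb D @^-1` B)) _ _) _.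
rewrite lerD ?cmp //; apply: le_trans prE1.
rewrite (prI_C P (mf B mB) mE) setIC addrAC subrr add0r ger0_norm ?pr_ge0 //.
rewrite -prC //; apply: pr_le.
- by apply: measurableI; [exact: mf|exact: measurableC].
- exact: measurableC.
- by move=> w [].
Qed.

Lemma le_of_vanishing (x y c : R) :
  (\forall m \near \oo, x <= y + c / m%:R) -> x <= y.
Proof.
move=> H; apply/ler_addgt0Pr => eps eps0.
have [m0 _ Hm] := H.
pose m := (maxn m0 (Num.bound (`|c| / eps))).+1.
have mR : 0 < m%:R :> R by rewrite ltr0n.
apply: le_trans (Hm m _) _; first by rewrite /= leqW // leq_maxl.
rewrite lerD2l ler_pdivrMr //; apply: le_trans (ler_norm c) _.
rewrite mulrC -ler_pdivrMr // ltW //.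
apply: lt_le_trans (archi_boundP _) _; first by rewrite divr_ge0 // ltW.
by rewrite ler_nat leqW // leq_maxr.
Qed.

Let q : R := 2 ^+ d.+1.

Let q1 : 1 <= q. Proof. by rewrite exprn_ege1 // ler1n. Qed.

Lemma pr_finite_bd_invariant r M (B : set (config d)) : gen_invariant mu ->
  (r <= M)%N -> local r B -> shift_inv B ->
  `|pr P (fb (boxf M) @^-1` B) - pr mu B| <= t * leak (d := d) q r t M.
Proof.
move=> gi rM lB sB; have mB := local_measurable lB.
apply: (@le_of_vanishing _ _ (4 * (t * #|` boxf M : {fset site d}|%:R) ^+ 2)).
exists (Num.bound (t * #|` boxf M.+1 : {fset site d}|%:R)).+1 => // m /= bm.
have m0 : (0 < m)%N by exact: leq_ltn_trans bm.
have mR : 0 < m%:R :> R by rewrite ltr0n.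
have tm1 : t * #|` boxf M.+1 : {fset site d}|%:R <= m%:R.
  apply: ltW; apply: lt_le_trans (archi_boundP _) _.
    by rewrite mulr_ge0 // ltW.
  by rewrite ler_nat; exact: ltnW.
have tm : t * #|` boxf M : {fset site d}|%:R <= m%:R.
  apply: le_trans tm1; rewrite ler_wpM2l ?(ltW t0) // ler_nat.
  exact/fsubset_leq_card/boxf_sub.
have te : m%:R * (t / m%:R) = t by rewrite mulrC divfK // gt_eqF.
apply: le_trans (ler_distD (mean mu (iter m (step (t / m%:R) (boxf M)) (\1_B))) _ _) _.
rewrite addrC; apply: lerD; last exact: pr_finite_bd.
have := @mean_iter_step R d mu (t / m%:R) q r M B m gi.
rewrite mulrA te; apply => //.
  by rewrite divr_ge0 // ltW.
by rewrite mulrAC ler_pdivrMr // mul1r.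
Qed.

(** Euler steps in the two boxes are exchanged one at a time, at a cost that does not depend on
    [M']; this uniformity controls the heights in all larger boxes. *)
Lemma pr_finite_bd_cauchy r M M' (B : set (config d)) :
  (r <= M)%N -> (M <= M')%N -> local r B ->
  `|pr P (fb (boxf M') @^-1` B) - pr P (fb (boxf M) @^-1` B)|
    <= t * leak (d := d) q r t M.
Proof.
move=> rM MM' lB; have mB := local_measurable lB.
pose c N := 4 * (t * #|` boxf N : {fset site d}|%:R) ^+ 2.
apply: (@le_of_vanishing _ _ (c M' + c M)).
exists (Num.bound (t * #|` boxf M' : {fset site d}|%:R)).+1 => // m /= bm.
have m0 : (0 < m)%N by exact: leq_ltn_trans bm.
have mR : 0 < m%:R :> R by rewrite ltr0n.
have tm' : t * #|` boxf M' : {fset site d}|%:R <= m%:R.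
  apply: ltW; apply: lt_le_trans (archi_boundP _) _.
    by rewrite mulr_ge0 // ltW.
  by rewrite ler_nat; exact: ltnW.
have tm : t * #|` boxf M : {fset site d}|%:R <= m%:R.
  apply: le_trans tm'; rewrite ler_wpM2l ?(ltW t0) // ler_nat.
  exact/fsubset_leq_card/boxf_sub.
have te : m%:R * (t / m%:R) = t by rewrite mulrC divfK // gt_eqF.
have e0 : 0 <= t / m%:R by rewrite divr_ge0 // ltW.
have eD' : t / m%:R * #|` boxf M' : {fset site d}|%:R <= 1.
  by rewrite mulrAC ler_pdivrMr // mul1r.
have eD : t / m%:R * #|` boxf M : {fset site d}|%:R <= 1.
  by rewrite mulrAC ler_pdivrMr // mul1r.
pose I N := mean mu (iter m (step (t / m%:R) (boxf N)) (\1_B)).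
have I_M' : `|I M' - I M| <= t * leak (d := d) q r t M.
  apply: mean_dist => [||h].
  - by apply: bmf_iter (bmf_indic mB); exact: bmf_step.
  - by apply: bmf_iter (bmf_indic mB); exact: bmf_step.
  rewrite -[X in X * leak _ _ _ _]te -mulrA; apply: iter_compare.
    by move=> G1 G2 b; exact: step_contract.
  move=> k km h'; rewrite -iterS -[t in leak _ _ t]te.
  by apply: step_leak => //; [exact: boxf_sub|exact: ltnW].
have PM' := pr_finite_bd mB m0 tm'; have PM := pr_finite_bd mB m0 tm.
rewrite mulrDl.
apply: le_trans (ler_distD (I M') _ _) _.
rewrite [leRHS]addrCA lerD //.
apply: le_trans (ler_distD (I M) _ _) _.
by rewrite lerD // distrC.
Qed.

End finite_volume.

(** * The infinite volume limit *)

(** The base [2 ^+ d.+1] is chosen to beat the volume by the crude bound M + 1 <= 2^M alone: (2M +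
    3)^d (M + 1) is at most 3^d 2^(M(d+1)). *)
Lemma leak_le {R : realType} (d r : nat) (t : R) M :
  leak (d := d) (2 ^+ d.+1) r t M <=
  3 ^+ d * ((2 ^+ d.+1) ^+ r * expR (t * (2 * d)%:R * 2 ^+ d.+1)) / M.+1%:R.
Proof.
set c := _ ^+ r * _; have c0 : 0 <= c by rewrite mulr_ge0 ?exprn_ge0 ?expR_ge0.
rewrite /leak -/c mulrCA [leRHS]mulrAC [leRHS]mulrC ler_wpM2l //.
rewrite ler_pdivlMr ?ltr0n // mulrAC ler_pdivrMr ?exprn_gt0 //.
rewrite -natrM -!natrX -natrM ler_nat -expnM.
have M2 : (M.+1 <= 2 ^ M)%N by exact: ltn_expl.
apply: (@leq_trans ((3 * 2 ^ M) ^ d * 2 ^ M)).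
  apply: (leq_mul _ M2); have [->|d0] := posnP d; rewrite ?expn0 // leq_exp2r //.
  by move: M2; lia.
rewrite expnMn -mulnA leq_mul2l -expnM -expnD leq_exp2l //.
by apply/orP; right; rewrite mulSn mulnS; lia.
Qed.

Section limit.
Context {R : realType} {d : nat} {disp : measure_display} {T : measurableType disp}.
Variables (P : probability T R) (C : site d -> T -> set R) (h0 : T -> config d)
  (mu : probability (config d) R).
Hypothesis C_poisson : forall x, poisson_process P 1 (C x).
Hypothesis C_indep : mutually_independent P (fun x => clock_sigma (C x)).
Hypothesis h0_law : has_law P h0 mu.
Hypothesis h0_indep : independent2 P (g_sigma_algebra_preimage h0)
  <<s \bigcup_x clock_sigma (C x) >>.
Hypothesis mu_inv : gen_invariant mu.

Variable t : R.
Hypothesis t0 : 0 < t.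

Let q : R := 2 ^+ d.+1.

Lemma leak_vanishes r (eps : R) : 0 < eps ->
  exists M0, forall M, (M0 <= M)%N -> t * leak (d := d) q r t M <= eps.
Proof.
move=> eps0; set c := 3 ^+ d * (q ^+ r * expR (t * (2 * d)%:R * q)).
have c0 : 0 <= c by rewrite !mulr_ge0 ?exprn_ge0 ?expR_ge0.
exists (Num.bound (t * c / eps)) => M M0M.
have MR : 0 < M.+1%:R :> R by rewrite ltr0n.
apply: le_trans (ler_wpM2l (ltW t0) (leak_le d r t M)) _; rewrite -/c mulrA.
rewrite ler_pdivrMr // [leRHS]mulrC -ler_pdivrMr // ltW //.
apply: lt_le_trans (archi_boundP _) _.
  by apply: divr_ge0; [apply: mulr_ge0 => //; exact: ltW|exact: ltW].
by rewrite ler_nat leqW.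
Qed.

Let fb M w := finite_bd (C^~ w) (boxf M) (h0 w) t.
Let cb w := continuous_bd (C^~ w) (h0 w) t.

Let mfb M : measurable_fun setT (fb M).
Proof. exact: (measurable_finite_bd C_poisson h0_law.1 _ (ltW t0)). Qed.

Let mcb : measurable_fun setT cb.
Proof. exact: (measurable_continuous_bd C_poisson h0_law.1 (ltW t0)). Qed.

Let lf w := clocks_locally_finite C_poisson w.

Let exceeds (x : site d) (K M : nat) := [set w | K%:Z < (fb M w x : int)].

Let mexceeds x K M : measurable (exceeds x K M).
Proof.
apply: (measurable_int_fibers (fun z => K%:Z < z)) => z.
exact: measurable_fun_site (mfb M).
Qed.

Let unbounded x := \bigcap_K \bigcup_M exceeds x K M.

Let munbounded x : measurable (unbounded x).
Proof.
apply: bigcap_countType_measurable => K _.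
by apply: bigcup_countType_measurable => M _; exact: mexceeds.
Qed.

(** The level [K] is chosen from the tail in one reference box [M1]; larger boxes change the
    probability of exceeding it by at most [eps / 2], and these events increase with the box. *)
Lemma pr_unbounded x : pr P (unbounded x) = 0.
Proof.
apply/eqP; rewrite eq_le pr_ge0 andbT; apply/ler_addgt0Pr => eps eps0; rewrite add0r.
have eps2 : 0 < eps / 2 by rewrite divr_gt0.
have [M0 M0P] := leak_vanishes (snorm x) eps2.
pose M1 := maxn M0 (snorm x).
have [K KP] := int_tail_small P (v := fun w => fb M1 w x)
  (fun z => measurable_fun_site x z (mfb M1)) eps2.
have mU : measurable (\bigcup_M exceeds x K M).
  by apply: bigcupT_measurable => M; exact: mexceeds.
apply: (@le_trans _ _ (pr P (\bigcup_M exceeds x K M))).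
  by apply: pr_le => // w; apply.
have ndF : nondecreasing_seq (exceeds x K).
  move=> M M' MM'; apply/subsetPset => w; rewrite /exceeds /= => /lt_le_trans; apply.
  exact: le_finite_bd (lf w) t0 (boxf_sub MM').
have /fine_cvgP[_ lim] : (P \o exceeds x K) @ \oo --> (pr P (\bigcup_M exceeds x K M))%:E.
  rewrite -prE //; exact: nondecreasing_cvg_mu.
apply: cvgr_to_le lim _; exists M1 => // M /= M1M.
have xM : (snorm x <= M1)%N by exact: leq_maxr.
have lB : local (snorm x) [set h : config d | K%:Z < (h x : int)].
  by move=> h h' hh' /=; rewrite hh'.
have := pr_finite_bd_cauchy C_poisson C_indep h0_law h0_indep t0 xM M1M lB.
move=> /(le_trans (ler_norm _)); rewrite lerBlDr => /le_trans; apply.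
rewrite [leRHS](splitr eps) lerD //; first by apply: M0P; exact: leq_maxl.
apply: le_trans (KP K (leqnn K)); apply: pr_le.
- exact: mexceeds.
- apply: (measurable_int_fibers (fun z => K%:Z < `|z|)) => z.
  exact: measurable_fun_site (mfb M1).
- by move=> w /= /lt_le_trans; apply; exact: ler_norm.
Qed.

Lemma not_unbounded x w : ~ unbounded x w ->
  exists M0, forall M, (M0 <= M)%N -> fb M w x = cb w x.
Proof.
move=> /existsNP[K /not_implyP[_ nK]].
have [|M0 M0P] := @bounded_stabilizes R d (C^~ w) (h0 w) t x K (lf w) t0.
  by move=> M; rewrite leNgt; apply/negP => KM; apply: nK; exists M.
by exists M0 => M M0M; exact: (M0P (boxf M) (boxf_sub M0M)).
Qed.

Let agree r M := \bigcap_(M' in [set M' | (M <= M')%N])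
  \bigcap_(z in [set z : site d | (snorm z <= r)%N]) [set w | fb M' w z = cb w z].

Let magree r M : measurable (agree r M).
Proof.
apply: bigcap_countType_measurable => M' _; apply: bigcap_countType_measurable => z _.
rewrite (_ : [set w | _] = \bigcup_(v : int) ([set w | fb M' w z = v] `&` [set w | cb w z = v])).
  apply: bigcup_countType_measurable => v _; apply: measurableI.
    exact: measurable_fun_site (mfb M').
  exact: measurable_fun_site mcb.
by apply/seteqP; split => [w /= fc|w [v _ [/= -> ->]]//]; exists (cb w z).
Qed.

(** Off the null events [unbounded z], for the finitely many [z] in [boxf r], every height in that
    box is eventually constant in [M]. *)
Lemma pr_agree r : (fun M => pr P (agree r M)) @ \oo --> (1 : R).
Proof.
have mU : measurable (\bigcup_M agree r M).
  by apply: bigcupT_measurable => M; exact: magree.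
have ndA : nondecreasing_seq (agree r).
  move=> M M' MM'; apply/subsetPset => w Aw M'' /= M'M''.
  by apply: Aw => /=; exact: leq_trans M'M''.
have U1 : pr P (\bigcup_M agree r M) = 1.
  have null (s : seq (site d)) : pr P (\bigcup_(z in [set` s]) unbounded z) = 0.
    have mB (s' : seq (site d)) : measurable (\bigcup_(z in [set` s']) unbounded z).
      by apply: bigcup_countType_measurable => z _; exact: munbounded.
    elim: s => [|z s IH]; first by rewrite bigcup0 /pr ?measure0.
    apply/eqP; rewrite eq_le pr_ge0 andbT.
    rewrite (_ : \bigcup_(_ in _) _ =
        unbounded z `|` \bigcup_(z in [set` s]) unbounded z); last first.
      apply/seteqP; split => w.
        by case=> y /=; rewrite inE => /predU1P[->|sy Uy]; [left|right; exists y].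
      by case=> [Uz|[y sy Uy]]; [exists z|exists y] => //=; rewrite inE ?eqxx ?[_ \in _]sy ?orbT.
    have U2 := prU_le P (munbounded z) (mB s). apply: le_trans U2 _.
    by rewrite IH pr_unbounded addr0.
  have mN : measurable (\bigcup_(z in [set` boxf r]) unbounded z).
    by apply: bigcup_countType_measurable => z _; exact: munbounded.
  have N1 : pr P (~` \bigcup_(z in [set` boxf r]) unbounded z) = 1.
    by rewrite prC // null subr0.
  apply/eqP; rewrite eq_le pr_le1 //= -[leLHS]N1; apply: pr_le => //.
    exact: measurableC.
  move=> w nU.
  have /choice[g gP] : forall z : site d, exists M0, (snorm z <= r)%N ->
      forall M, (M0 <= M)%N -> fb M w z = cb w z.
    move=> z; have [zr|zr] := boolP (snorm z <= r)%N; last by exists 0%N.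
    have [M0 M0P] : exists M0, forall M, (M0 <= M)%N -> fb M w z = cb w z.
      apply: not_unbounded => Uz; apply: nU; exists z => //=.
      by rewrite in_boxf.
    by exists M0.
  exists (\max_(z <- boxf r) g z)%N => // M /= gM z zr.
  apply: gP => //; apply: leq_trans gM.
  by apply: (leq_bigmax_seq (F := g)) => //; rewrite in_boxf.
have : (P \o agree r) @ \oo --> (1 : R)%:E.
  rewrite -U1 -prE //; exact: nondecreasing_cvg_mu.
by move=> /fine_cvgP[].
Qed.

Lemma pr_continuous_bd r (B : set (config d)) : local r B -> shift_inv B ->
  pr P (cb @^-1` B) = pr mu B.
Proof.
move=> lB sB; have mB := local_measurable lB.
have mc : measurable (cb @^-1` B) by exact: measurable_preimageT mcb mB.
have mf M : measurable (fb M @^-1` B) by exact: measurable_preimageT (mfb M) mB.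
apply/eqP; rewrite -subr_eq0 -normr_le0; apply/ler_addgt0Pr => eps eps0; rewrite add0r.
have eps2 : 0 < eps / 2 by rewrite divr_gt0.
have [M0 M0P] := leak_vanishes r eps2.
have A0 : (fun M => pr P (agree r M) - 1) @ \oo --> (0 : R).
  by rewrite -[X in _ --> X](subrr (1 : R)); apply: cvgB; [exact: pr_agree|exact: cvg_cst].
have [M1 _ M1P] : \forall M \near \oo, `|pr P (agree r M) - 1| <= eps / 2.
  by move/cvgr0_norm_le : A0; apply.
pose M := maxn r (maxn M0 M1).
have rM : (r <= M)%N by exact: leq_maxl.
have M0M : (M0 <= M)%N by rewrite /M !leq_max leqnn orbT.
have M1M : (M1 <= M)%N by rewrite /M !leq_max leqnn !orbT.
apply: le_trans (ler_distD (pr P (fb M @^-1` B)) _ _) _.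
rewrite [leRHS](splitr eps) lerD //; last first.
  apply: le_trans (M0P M M0M).
  exact: (pr_finite_bd_invariant C_poisson C_indep h0_law h0_indep t0 mu_inv rM lB sB).
apply: le_trans (M1P M M1M); rewrite [leRHS]distrC [leRHS]ger0_norm ?subr_ge0 ?pr_le1 //.
(* On [agree r M] the two events coincide, so their probabilities differ by at most that of the
   complement. *)
rewrite (prI_C P mc (magree r M)) (prI_C P (mf M) (magree r M)).
have -> : cb @^-1` B `&` agree r M = fb M @^-1` B `&` agree r M.
  apply/seteqP; split => w [Bw Aw]; split => //; rewrite /preimage /= in Bw *;
    apply: lB Bw => z zr; have /= := Aw M (leqnn M) z zr; by [move=> ->|move=> <-].
rewrite opprD addrACA subrr add0r -prC //.
have mCA := measurableC (magree r M).
have b1 : pr P (cb @^-1` B `&` ~` agree r M) <= pr P (~` agree r M).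
  apply: pr_le; [exact: measurableI|exact: mCA|by move=> w []].
have b2 : pr P (fb M @^-1` B `&` ~` agree r M) <= pr P (~` agree r M).
  apply: pr_le; [exact: measurableI|exact: mCA|by move=> w []].
have b3 := pr_ge0 P (cb @^-1` B `&` ~` agree r M).
have b4 := pr_ge0 P (fb M @^-1` B `&` ~` agree r M).
by rewrite ler_norml; apply/andP; split; lra.
Qed.

End limit.

(** The preimage of a local event under [recenter] is local and shift-invariant, so its probability
    is preserved by the dynamics; by the pinning, [mu] gives it the same mass as the event
    itself. *)
Lemma gen_invariant_stationary {R : realType} {d : nat}
  (mu : probability (config d) R) : gen_invariant mu ->
  pr mu [set h : config d | (h 0 : int) = 0] = 1 -> stationary mu.
Proof.
move=> gi pinned disp T P C h0 Cp Ci hl hi t t0.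
have lZ : local 0 [set h : config d | (h 0 : int) = 0].
  by move=> h h' hh' /= <-; rewrite hh' ?snorm0.
have mZ := local_measurable lZ.
have rec M B : local M B -> pr mu (@recenter d @^-1` B) = pr mu B.
  move=> lB; have mB := local_measurable lB.
  have mrB := local_measurable (local_recenter lB).
  rewrite (pr_setI_full mrB mZ pinned) (pr_setI_full mB mZ pinned); congr (pr mu _).
  apply/seteqP; split => h [Bh h0'].
    split => //; move: Bh; rewrite /preimage /=; congr (B _).
    by apply: config_eq => x; rewrite /recenter h0' subr0.
  split => //; rewrite /preimage /=; move: Bh; congr (B _).
  by apply: config_eq => x; rewrite /recenter h0' subr0.
have mc := measurable_continuous_bd Cp hl.1 t0.
apply: local_law_unique.
  apply: (@measurableT_comp _ _ _ _ _ _ (@recenter d)); last exact: mc.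
  exact: measurable_recenter.
move=> M B lB.
have lrB := local_recenter lB.
have mB := local_measurable lB; have mrB := local_measurable lrB.
have srB : shift_inv (@recenter d @^-1` B).
  by move=> c h; rewrite /preimage /= recenter_raise.
have mP : measurable ((fun w => continuous_bd (C^~ w) (h0 w) t) @^-1` (@recenter d @^-1` B)).
  exact: measurable_preimageT mc mrB.
rewrite -[LHS]/(P ((fun w => continuous_bd (C^~ w) (h0 w) t) @^-1` (@recenter d @^-1` B))).
rewrite (prE P mP) (prE mu mB) -(rec M B lB); congr (_%:E).
move: t0; rewrite le_eqVlt => /predU1P[t0|t0].
  rewrite -t0 /pr -(hl.2 _ mrB); congr (fine (P _)).
  by apply/seteqP; split => w; rewrite /preimage /= continuous_bd0.
exact: (pr_continuous_bd Cp Ci hl hi gi t0 lrB srB).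
Qed.

Theorem theorem1p2 (R : realType) (d : nat) (d_ge1 : (1 <= d)%N)
  (p : nat -> R)
  (p01 : forall N, (1 <= N)%N -> 0 < p N < 1)
  (p_lower : much_less (fun N => N%:R ^- (d + 1)) p)
  (p_upper : much_less p (fun N => N%:R ^- d))
  (disp : nat -> measure_display)
  (T : forall N, measurableType (disp N))
  (P : forall N, probability (T N) R)
  (X : forall N, nat -> {RV (P N) >-> site d})
  (n : forall N, {RV (P N) >-> nat})
  (f := fun N (m : nat) (w : T N) => discrete_bd (fun k => X N k w) m)
  (X_unif : forall N k, (1 <= N)%N -> uniform_on (P N) (X N k) (box d N))
  (X_indep : forall N, (1 <= N)%N ->
    mutually_independent (P N) (fun k => g_sigma_algebra_preimage (X N k)))
  (n_geom : forall N, (1 <= N)%N -> geometric_law (P N) (n N) (p N))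
  (n_indep : forall N, (1 <= N)%N ->
    independent2 (P N) (g_sigma_algebra_preimage (n N))
      (generated_sigma (f N)))
  (u := fun N (w : T N) => recenter (f N (n N w) w)) :
  [/\ forall N, (1 <= N)%N -> measurable_fun setT (u N),
      tight P [set N | (1 <= N)%N] u &
      forall (phi : nat -> nat) (mu : probability (config d) R),
        (1 <= phi 0)%N -> {homo phi : i j / (i < j)%N} ->
        weakly_converges (fun k => P (phi k)) (fun k => u (phi k)) mu ->
        stationary mu].
Proof.
pose Y N k w := X N k w; pose m N w := n N w.
have mY N k : measurable_fun setT (@Y N k) by exact: measurable_funPT.
have mm N : measurable_fun setT (@m N) by exact: measurable_funPT.
split.
- by move=> N _; exact: (measurable_u mY mm).
- exact: (tight_u p01 p_upper mY mm X_unif X_indep n_geom n_indep).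
move=> phi mu phi0 phi_homo phi_cvg; apply: gen_invariant_stationary.
  exact: (limit_gen_invariant p01 p_upper mY mm X_unif X_indep n_geom n_indep
    phi0 phi_homo phi_cvg).
exact: (limit_pinned mY mm phi_cvg).
Qed.
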